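(* Let $\mathcal{M}$ be Smith's nonmetric pseudo-arc. Then any Cartesian power $\mathcal{M}^\kappa$ (for any nonempty index set $\kappa$) has the fupcon property; that is, for every continuum $M\subseteq \mathcal{M}^\kappa$ whose projection onto each coordinate space is all of $\mathcal{M}$, and for every open set $U\subseteq\mathcal{M}^\kappa$ with $M\subseteq U$, there exists an open connected set $V$ with $M\subseteq V\subseteq U$.
   Context: A continuum is a nonempty compact connected Hausdorff space. Smith's nonmetric pseudo-arc $\mathcal{M}$ (constructed by M. Smith in 1985) is a Hausdorff, chainable, homogeneous, hereditarily equivalent and hereditarily indecomposable nonmetric continuum; it can be represented as a long inverse limit $\varprojlim\{P_\alpha, p^\beta_\alpha : \alpha<\beta<\omega_1\}$ where each $P_\alpha$ is a metric pseudo-arc and each bonding map $p^\beta_\alpha:P_\beta\to P_\alpha$ is open, closed and monotone with $(p^\beta_\alpha)^{-1}(x)$ a pseudo-arc for every $x\in P_\alpha$. A product $\prod_{i} X_i$ of continua has the fupcon property if every subcontinuum $M$ of the product whose projection onto every coordinate space $X_i$ is onto has, for every open $U\supseteq M$, an open connected $V$ with $M\subseteq V\subseteq U$. *)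

(* Defs.v *)
From HB Require Import structures.
From mathcomp Require Import all_boot all_order all_algebra.
From mathcomp Require Import all_classical all_reals all_analysis.
Set Implicit Arguments. Unset Strict Implicit. Unset Printing Implicit Defensive.
Import Order.TTheory GRing.Theory Num.Theory.
Local Open Scope classical_set_scope.

(* A continuum (as a subset of an ambient Hausdorff space): nonempty,
   compact, connected. *)
Definition continuum {T : topologicalType} (A : set T) : Prop :=
  A !=set0 /\ compact A /\ connected A.

Definition indecomposable {T : topologicalType} (A : set T) : Prop :=
  continuum A /\
  ~ (exists B C : set T, continuum B /\ continuum C /\ B `<` A /\ C `<` A
        /\ A = B `|` C).

Definition hereditarily_indecomposable {T : topologicalType} (A : set T) :=
  continuum A /\ forall B : set T, B `<=` A -> continuum B -> indecomposable B.

Definition chainable {T : topologicalType} (A : set T) : Prop :=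
  forall U : set (set T), (forall O, U O -> open O) -> A `<=` \bigcup_(O in U) O ->
  exists (n : nat) (C : nat -> set T),
    (forall i, (i < n)%N ->
       (exists O, open O /\ C i = O `&` A) /\ (exists O, U O /\ C i `<=` O)) /\
    A `<=` \bigcup_(i in [set i | (i < n)%N]) C i /\
    (forall i j, (i < n)%N -> (j < n)%N ->
       (C i `&` C j !=set0 <-> (i <= j.+1)%N /\ (j <= i.+1)%N)).

(* A pseudo-arc: a nondegenerate chainable hereditarily indecomposable
   continuum (here always inside a metric (Hausdorff pseudometric) space,
   so it is a metric continuum; by Bing's theorem this determines it up to
   homeomorphism). *)
Definition pseudo_arc {T : topologicalType} (A : set T) : Prop :=
  continuum A /\ chainable A /\ hereditarily_indecomposable A /\
  (exists x y, A x /\ A y /\ x <> y).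

(* (I, lt) is order isomorphic to the first uncountable ordinal omega_1:
   a well-founded strict total order, uncountable, with all proper initial
   segments countable. *)
Definition omega1_like (I : Type) (lt : I -> I -> Prop) : Prop :=
  (forall a, ~ lt a a) /\
  (forall a b c, lt a b -> lt b c -> lt a c) /\
  (forall a b, lt a b \/ a = b \/ lt b a) /\
  well_founded lt /\
  ~ countable [set: I] /\
  (forall a, countable [set b | lt b a]).

(* The inverse system {P_alpha, p^beta_alpha : alpha < beta < omega_1}
   of Smith's representation: metric pseudo-arcs P_alpha, bonding maps
   p b a : P_b -> P_a (used for a < b) that are continuous, compatible,
   open, closed, monotone and with all point-fibres pseudo-arcs. *)
Definition smith_system {R : realType} (I : Type) (lt : I -> I -> Prop)
  (P : I -> pseudoMetricType R) (p : forall b a : I, P b -> P a) : Prop :=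
  omega1_like lt /\
  (forall a, hausdorff_space (P a)) /\
  (forall a, pseudo_arc [set: P a]) /\
  (forall a b, lt a b -> continuous (p b a)) /\
  (forall a b c, lt a b -> lt b c -> forall x, p b a (p c b x) = p c a x) /\
  (forall a b, lt a b -> forall O : set (P b), open O -> open (p b a @` O)) /\
  (forall a b, lt a b -> forall O : set (P b), closed O -> closed (p b a @` O)) /\
  (forall a b, lt a b -> forall y : P a, connected (p b a @^-1` [set y])) /\
  (forall a b, lt a b -> forall y : P a, pseudo_arc (p b a @^-1` [set y])).

Arguments smith_system {R I} lt P p.

Definition inv_limit {R : realType} (I : Type) (lt : I -> I -> Prop)
  (P : I -> pseudoMetricType R) (p : forall b a : I, P b -> P a)
  : set (prod_topology P) :=
  [set x | forall a b, lt a b -> p b a (x b) = x a].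

Arguments inv_limit {R I} lt P p.

Definition cpower {T : topologicalType} (K : Type) (X : set T)
  : set (prod_topology (fun _ : K => T)) :=
  [set f | forall k, X (f k)].

Arguments cpower {T} K X.

Definition rel_open {T : topologicalType} (S V : set T) : Prop :=
  exists W : set T, open W /\ V = W `&` S.

Definition fupcon_power {T : topologicalType} (K : Type) (X : set T) : Prop :=
  forall M : set (prod_topology (fun _ : K => T)),
    M `<=` cpower K X -> continuum M ->
    (forall k, [set f k | f in M] = X) ->
    forall U, U `<=` cpower K X -> rel_open (cpower K X) U -> M `<=` U ->
    exists V, rel_open (cpower K X) V /\ connected V /\ M `<=` V /\ V `<=` U.

Arguments fupcon_power {T} K X.

(* Main.v *)
Require Import Defs.
From HB Require Import structures.
From mathcomp Require Import all_boot all_order all_algebra.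
From mathcomp Require Import all_classical all_reals all_analysis.
From mathcomp Require Import lra zify.

(* Every power of a chainable hereditarily indecomposable continuum [X] has
   small connected neighbourhoods of its full subcontinua, and both properties
   of [X] pass to inverse limits.

   Let [M] be a continuum and [f : M -> X] a surjective coordinate.  The point is
   to move the coordinate of a single [m] in [M] from [f m] to a nearby [x']:
   the pairs [(b, s)] with [s] in [M] and [b] close to [f s] should contain a
   connected set joining [(x', m)] to the graph of [f].  In a hereditarily
   indecomposable chainable continuum every point is an end point, so there is a
   map [e : X -> R] with small fibres that is minimal at [f m] and at [x'].  A
   discrete walk in [M] from [m] to a maximum of [e \o f] induces a walk [g] in
   [R], and hereditary indecomposability allows [e] to be lifted through [g]: each
   [b] in [X] is assigned a step of the walk over which [e] is close to [e b],
   starting with [x'] over [m].  This lift connects [(x', m)] to some [(b, s)] for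
   every [b] in [X]; and, as [X] is chainable, [b = f s] happens somewhere.

   Moving finitely many coordinates one after the other, and all the others at
   once, shows that the union of the continua between [M] and [U] is open. *)

Set Implicit Arguments. Unset Strict Implicit. Unset Printing Implicit Defensive.
Import Order.TTheory GRing.Theory Num.Theory.
Import numFieldNormedType.Exports.
Local Open Scope classical_set_scope.
Local Open Scope ring_scope.

(** * Compactness and components *)

(** If [Phi K] fails, the sets whose complement in [K] satisfies [Phi] form a proper filter
    containing [K], and the local truth of [Phi] at a cluster point is absurd. This replaces the
    choice of finite subcovers. *)
Lemma compact_local_global (T : topologicalType) (K : set T)
    (Phi : set T -> Prop) :
  compact K -> Phi set0 ->
  (forall A B, A `<=` B -> Phi B -> Phi A) ->
  (forall A B, Phi A -> Phi B -> Phi (A `|` B)) ->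
  (forall x, K x -> exists O, [/\ open O, O x & Phi (O `&` K)]) ->
  Phi K.
Proof.
move=> cK P0 Pmono PU Ploc; apply: contrapT => nPK.
pose F : set_system T := [set A | Phi (K `\` A)].
have FF : ProperFilter F.
  split; first by rewrite /F /= setD0.
  split.
  - by rewrite /F /= setDT.
  - by move=> A B FA FB; rewrite /F /= setDIr; exact: PU.
  - by move=> A B AB FA; apply: Pmono FA; exact: setDS.
have FK : F K by rewrite /F /= setDv.
have [x [Kz Fz]] := cK F FF FK.
have [W [oW Wx PW]] := Ploc _ Kz.
have FW : F (~` W) by rewrite /F /= setDE setCK setIC.
by have [y []] := Fz _ _ FW (open_nbhs_nbhs (conj oW Wx)).
Qed.

(** Mostly applied to a set [K] of bad points or pairs: if no single [F j] misses [K], some bad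
    point lies in all the [F j] at once. *)
Lemma compact_directed_inter (T : topologicalType) (K : set T) (J : Type)
    (F : J -> set T) (j0 : J) :
  compact K -> (forall j, closed (F j)) ->
  (forall i j, exists k, F k `<=` F i `&` F j) ->
  (forall j, F j `&` K !=set0) ->
  exists x, K x /\ forall j, F j x.
Proof.
move=> cK cF dF nF; apply: contrapT => nx.
suff [j Fj] : exists j, F j `&` K = set0.
  by have [x] := nF j; rewrite Fj.
apply: (@compact_local_global T K (fun A => exists j, F j `&` A = set0)) => //.
- by exists j0; rewrite setI0.
- move=> A B AB [j FB]; exists j; rewrite -subset0 -FB; exact: setIS.
- move=> A B [i Fi] [j Fj]; have [k Fk] := dF i j; exists k.
  rewrite -subset0 => x [/Fk [Fix Fjx]] [Ax|Bx].
    by rewrite -Fi.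
  by rewrite -Fj.
- move=> x Kx; have [j Fj] : exists j, ~ F j x.
    by apply/existsNP => Fx; apply: nx; exists x.
  exists (~` F j); split => //; first by rewrite openC.
  by exists j; rewrite setIA setICr set0I.
Qed.

Lemma compact_separation (T : topologicalType) (A B : set T) :
  hausdorff_space T -> compact A -> compact B -> A `&` B = set0 ->
  exists U V, [/\ open U, open V, A `<=` U, B `<=` V & U `&` V = set0].
Proof.
rewrite open_hausdorff => hT cA cB AB0.
apply: (@compact_local_global T A (fun A' =>
  exists U V, [/\ open U, open V, A' `<=` U, B `<=` V & U `&` V = set0])) => //.
- exists set0, setT; split => //; [exact: open0|exact: openT|exact: set0I].
- by move=> C D CD [U [V [oU oV DU BV UV]]]; exists U, V; split => // x /CD/DU.
- move=> C D [U [V [oU oV CU BV UV]]] [U' [V' [oU' oV' DU' BV' UV']]].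
  exists (U `|` U'), (V `&` V'); split; [exact: openU|exact: openI| | |].
  + by move=> x [/CU|/DU']; [left|right].
  + by move=> x Bx; split; [exact: BV|exact: BV'].
  + by rewrite setIUl setIA UV set0I set0U setIC -setIA (setIC V') UV' setI0.
- move=> x Ax.
  have [U [V [oU oV Ux BV UV]]] : exists U V,
      [/\ open U, open V, U x, B `<=` V & U `&` V = set0].
    apply: (@compact_local_global T B (fun B' =>
      exists U V, [/\ open U, open V, U x, B' `<=` V & U `&` V = set0])) => //.
    + by exists setT, set0; split => //; [exact: openT|exact: open0|exact: setI0].
    + by move=> C D CD [U [V [? ? ? DV ?]]]; exists U, V; split => // z /CD/DV.
    + move=> C D [U [V [oU oV Ux CV UV]]] [U' [V' [oU' oV' Ux' DV' UV']]].
      exists (U `&` U'), (V `|` V'); split => //; [exact: openI|exact: openU| |].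
        by move=> z [/CV|/DV']; [left|right].
      by rewrite setIUr -setIA (setIC U') setIA UV set0I set0U -setIA UV' setI0.
    + move=> y By; have xy : x != y.
        apply/eqP => xy; have : (A `&` B) x by split => //; rewrite xy.
        by rewrite AB0.
      have [[U V] /= [Ux Vy] [oU oV /eqP UV]] := hT _ _ xy.
      move: Ux Vy => /set_mem Ux /set_mem Vy; exists V; split => //.
      by exists U, V; split => // z [].
  by exists U; split => //; exists U, V; split => // z [].
Qed.

Lemma connected_sub_closed (T : topologicalType) (C F1 F2 : set T) :
  connected C -> closed F1 -> closed F2 -> F1 `&` F2 = set0 ->
  C `<=` F1 `|` F2 -> C `&` F1 !=set0 -> C `<=` F1.
Proof.
move=> cC cF1 cF2 F12 CF [x [Cx F1x]].
have sF : separated F1 F2.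
  by split; rewrite -((closure_id _).1 _).
have [//|CF2] := connected_subset sF CF cC.
have : (F1 `&` F2) x by split => //; exact: CF2.
by rewrite F12.
Qed.

(** Components of a compact Hausdorff space are quasi-components: the intersection [Q] of all
    relatively clopen sets containing [x] is connected, hence inside the component, and by
    compactness one such clopen set already lies in [O]. *)
Lemma component_clopen (T : topologicalType) (K O : set T) (x : T) :
  hausdorff_space T -> compact K -> K x -> open O ->
  connected_component K x `<=` O ->
  exists G, [/\ closed G, closed (K `\` G), connected_component K x `<=` G,
    G `<=` K & G `<=` O].
Proof.
move=> hT cK Kx oO CO.
suff [G [cG cKG Gx GK GO]] : exists G,
    [/\ closed G, closed (K `\` G), G x, G `<=` K & G `<=` O].
  exists G; split => //; apply: (connected_sub_closed _ cG cKG).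
  - exact: component_connected.
  - by rewrite setDE setICA setICr setI0.
  - move=> z /connected_component_sub Kz.
    by have [|nGz] := pselect (G z); [left|right].
  - by exists x; split => //; exact: connected_component_refl.
have clK := compact_closed hT cK.
pose Cl : set (set T) :=
  [set G | [/\ closed G, closed (K `\` G), G x & G `<=` K]].
have ClI G H : Cl G -> Cl H -> Cl (G `&` H).
  move=> [cG cKG Gx GK] [cH cKH Hx HK]; split => //; first exact: closedI.
    by rewrite setDIr; exact: closedU.
  by move=> z [/GK].
have ClK : Cl K by split => //; rewrite setDv; exact: closed0.
pose Q := \bigcap_(G in Cl) G.
have Qx : Q x by move=> G; case=> _ _ Gx _; exact: Gx.
have clQ : closed Q by apply: closed_bigI => G; case=> cG _ _ _; exact: cG.
have QK : Q `<=` K by apply: bigcap_inf.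
have inside W : open W -> Q `<=` W -> exists2 G, Cl G & G `<=` W.
  move=> oW QW.
  have [G ClG GW] : exists2 G, Cl G & (K `&` ~` W) `<=` ~` G.
    apply: (@compact_local_global T (K `&` ~` W)
      (fun A => exists2 G, Cl G & A `<=` ~` G)).
    - by apply: compact_closedI => //; rewrite closedC.
    - by exists K => //; exact: sub0set.
    - by move=> A B AB [G ClG BG]; exists G => // z /AB/BG.
    - move=> A B [G ClG AG] [H ClH BH]; exists (G `&` H); first exact: ClI.
      by move=> z [/AG nG [] //|/BH nH []].
    - move=> z [Kz nWz]; have [G ClG nGz] : exists2 G, Cl G & ~ G z.
        apply: contrapT => h; apply: nWz; apply: QW => G ClG.
        by apply: contrapT => nGz; apply: h; exists G.
      exists (~` G); split => //; first by rewrite openC; case: ClG.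
      by exists G => // t [].
  exists G => // z Gz; apply: contrapT => nWz.
  by apply: (GW z) => //; split => //; case: ClG => _ _ _; apply.
suff cQ : connected Q.
  have [G [cG cKG Gx GK] GO] : exists2 G, Cl G & G `<=` O.
    apply: inside => //; apply: subset_trans CO.
    exact: connected_component_max.
  by exists G.
move=> B B0 [C1 oC1 BC1] [C2 cC2 BC2].
have clB : closed B by rewrite BC2; exact: closedI.
have clQB : closed (Q `\` B).
  rewrite BC1 setDIr setDv set0U setDE.
  by apply: closedI => //; rewrite closedC.
have cB : compact B.
  by apply: (subclosed_compact clB cK); rewrite BC2; apply: subset_trans QK => z [].
have cQB : compact (Q `\` B).
  by apply: (subclosed_compact clQB cK); apply: subset_trans QK => z [].
(* A splitting of [Q] into [B] and the rest is widened to disjoint open sets. Some member of [Cl]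
   lies in their union, and its part on the side of [x] is again in [Cl], so [Q] cannot reach the
   other side. *)
have [U1 [U2 [oU1 oU2 BU1 BU2 U12]]] : exists U1 U2,
    [/\ open U1, open U2, B `<=` U1, Q `\` B `<=` U2 & U1 `&` U2 = set0].
  by apply: compact_separation => //; rewrite setIDA setIC setDE -setIA setICr setI0.
have split_cl U V G : open U -> open V -> U `&` V = set0 -> Cl G ->
    G `<=` U `|` V -> U x -> Cl (G `&` U).
  move=> oU oV UV [cG cKG Gx GK] GUV Ux; split => //.
  - rewrite (_ : G `&` U = G `\` V).
      by rewrite setDE; apply: closedI => //; rewrite closedC.
    apply/seteqP; split => z [Gz Uz]; split => //.
      by move=> Vz; have : (U `&` V) z by []; rewrite UV.
    by have [|/Uz] := GUV z Gz.
  - rewrite setDIr; apply: closedU => //.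
    by rewrite setDE; apply: closedI => //; rewrite closedC.
  - by move=> z [/GK].
have [G ClG GU] : exists2 G, Cl G & G `<=` U1 `|` U2.
  apply: inside; first exact: openU.
  by move=> z Qz; have [/BU1|Bz] := pselect (B z); [left|right; apply: BU2].
have [Bx|nBx] := pselect (B x).
  have /(_ (BU1 _ Bx)) ClGU := split_cl _ _ _ oU1 oU2 U12 ClG GU.
  apply/seteqP; split; first by rewrite BC2 => z [].
  move=> z Qz; apply: contrapT => nBz.
  have : (U1 `&` U2) z by split; [have [] := Qz _ ClGU|exact: BU2].
  by rewrite U12.
have /(_ (BU2 _ (conj Qx nBx))) ClGU : U2 x -> Cl (G `&` U2).
  by apply: (split_cl _ U1) => //; [rewrite setIC|rewrite setUC].
case: B0 => z Bz; have Qz : Q z by move: Bz; rewrite BC2 => -[].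
have : (U1 `&` U2) z by split; [exact: BU1|have [] := Qz _ ClGU].
by rewrite U12.
Qed.

(** * Separating levels of a function *)

(** The form in which hereditary indecomposability is used: the union of two incomparable continua
    that meet would be decomposable. *)
Definition nested_continua (T : topologicalType) := forall A B : set T,
  continuum A -> continuum B -> A `&` B !=set0 -> A `<=` B \/ B `<=` A.

(* The closeness relations [|q z - q w| <= 1] form a filter base: the
   form in which chainability is used. *)
Definition directed_functions (R : realType) (T : topologicalType) :=
  forall u1 u2 : T -> R, continuous u1 -> continuous u2 ->
  exists2 q : T -> R, continuous q & forall z w, `|q z - q w| <= 1 ->
    `|u1 z - u1 w| <= 1 /\ `|u2 z - u2 w| <= 1.

Section real_level_sets.
Context {R : realType} {T : topologicalType}.
Implicit Types e : T -> R.

Lemma closed_sublevel e c : continuous e -> closed [set z | e z <= c].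
Proof. by move/continuous_closedP => h; exact: h _ (@closed_le R c). Qed.

Lemma closed_superlevel e c : continuous e -> closed [set z | c <= e z].
Proof. by move/continuous_closedP => h; exact: h _ (@closed_ge R c). Qed.

Lemma open_sublevel e c : continuous e -> open [set z | e z < c].
Proof. by move/continuousP => h; exact: h _ (@open_lt R c). Qed.

Lemma open_superlevel e c : continuous e -> open [set z | c < e z].
Proof. by move/continuousP => h; exact: h _ (@open_gt R c). Qed.

Lemma opp_fun_continuous e : continuous e -> continuous (fun z => - e z).
Proof.
by move=> ce z; apply: continuous_comp; [exact: ce|exact: opp_continuous].
Qed.

Lemma add_fun_continuous e f :
  continuous e -> continuous f -> continuous (fun z => e z + f z).
Proof. by move=> ce cf z; apply: (@cvgD R R^o); [exact: ce|exact: cf]. Qed.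

Lemma max_fun_continuous e f :
  continuous e -> continuous f -> continuous (fun z => Num.max (e z) (f z)).
Proof. by move=> ce cf z; exact: (continuous_max (ce z) (cf z)). Qed.

Lemma scale_fun_continuous (k : R) e :
  continuous e -> continuous (fun z => k * e z).
Proof.
by move=> ce z; apply: continuous_comp; [exact: ce|exact: mulrl_continuous].
Qed.

Lemma norm_fun_continuous e : continuous e -> continuous (fun z => `|e z|).
Proof. by move=> ce z; apply: (@cvg_norm R R^o); exact: ce. Qed.

End real_level_sets.

Lemma component_continuum (T : topologicalType) (K : set T) x :
  hausdorff_space T -> compact K -> K x -> continuum (connected_component K x).
Proof.
move=> hT cK Kx; split; first by exists x; exact: connected_component_refl.
split; last exact: component_connected.
apply: (subclosed_compact _ cK); last exact: connected_component_sub.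
by apply: component_closed; exact: compact_closed.
Qed.

Section crooked.
Context {R : realType} {T : topologicalType}.
Hypotheses (hT : hausdorff_space T) (cT : compact [set: T]).
Hypothesis nT : nested_continua T.
Implicit Types (Y : set T) (e : T -> R).

Let closed_compact Y : closed Y -> compact Y.
Proof. by move=> cY; exact: (subclosed_compact cY cT). Qed.

(* A component of [e <= b2] meeting [e <= a1] cannot be nested with a component
   of [a2 <= e] meeting [b1 <= e], so the two families are disjoint and can be
   separated by relatively clopen sets. *)
Lemma crooked_clopen Y e a1 a2 b1 b2 : closed Y -> continuous e ->
  a1 < a2 -> b2 < b1 -> a1 <= b2 -> a2 <= b1 ->
  exists G H : set T,
    [/\ closed G, closed ((Y `&` [set z | e z <= b2]) `\` G),
        G `<=` Y `&` [set z | e z <= b2] & Y `&` [set z | e z <= a1] `<=` G] /\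
    [/\ closed H, closed ((Y `&` [set z | a2 <= e z]) `\` H),
        H `<=` Y `&` [set z | a2 <= e z], Y `&` [set z | b1 <= e z] `<=` H
      & G `&` H = set0].
Proof.
move=> cY ce a12 b21 ab ab'.
pose K := Y `&` [set z | e z <= b2]; pose L := Y `&` [set z | a2 <= e z].
have clK : closed K by apply: closedI => //; exact: closed_sublevel.
have clL : closed L by apply: closedI => //; exact: closed_superlevel.
pose A := Y `&` [set z | e z <= a1]; pose B := Y `&` [set z | b1 <= e z].
have clA : closed A by apply: closedI => //; exact: closed_sublevel.
have clB : closed B by apply: closedI => //; exact: closed_superlevel.
have AK : A `<=` K by move=> z [Yz /= ez]; split => //=; lra.
have BL : B `<=` L by move=> z [Yz /= ez]; split => //=; lra.
pose cl (K G : set T) := [/\ closed G, closed (K `\` G) & G `<=` K].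
have clU K' G G' : cl K' G -> cl K' G' -> cl K' (G `|` G').
  move=> [cG cKG GK] [cG' cKG' GK']; split; first exact: closedU.
    by rewrite setDUr; exact: closedI.
  by move=> z [/GK|/GK'].
have clI K' G G' : cl K' G -> cl K' G' -> cl K' (G `&` G').
  move=> [cG cKG GK] [cG' cKG' GK']; split; first exact: closedI.
    by rewrite setDIr; exact: closedU.
  by move=> z [/GK].
have cl0 K' : closed K' -> cl K' set0.
  by move=> ?; split; [exact: closed0|rewrite setD0|exact: sub0set].
have clT K' : closed K' -> cl K' K'.
  by move=> ?; split => //; rewrite setDv; exact: closed0.
have clO K' G : cl K' G -> open (~` (K' `\` G)).
  by move=> [_ cKG _]; rewrite openC.
(* [sep] passes to finite unions in each argument, so compactness of [A] and then of [B] reduces the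
   claim to one point of each. *)
pose sep A' B' := exists G H,
  [/\ cl K G, cl L H, A' `<=` G, B' `<=` H & G `&` H = set0].
suff [G [H [[? ? ?] [? ? ?] ? ? ?]]] : sep A B by exists G, H.
apply: (@compact_local_global T A (fun A' => sep A' B)).
- exact: closed_compact.
- by exists set0, L; split => //; [exact: cl0|exact: clT|rewrite set0I].
- by move=> C D CD [G [H [? ? DG ? ?]]]; exists G, H; split => // z /CD/DG.
- move=> C D [G [H [cG cH CG BH GH]]] [G' [H' [cG' cH' DG' BH' GH']]].
  exists (G `|` G'), (H `&` H'); split; [exact: clU|exact: clI| | |].
  + by move=> x [/CG|/DG']; [left|right].
  + by move=> x Bx; split; [exact: BH|exact: BH'].
  + by rewrite setIUl setIA GH set0I set0U setIC -setIA (setIC H') GH' setI0.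
move=> x Ax.
suff [G [H [cG cH xG BH GH]]] : sep [set x] B.
  exists (~` (K `\` G)); split; first exact: clO.
    by move=> -[_]; apply; exact: xG.
  exists G, H; split => // z [nz Az]; apply: contrapT => nGz; apply: nz.
  by split => //; exact: AK.
apply: (@compact_local_global T B (sep [set x])).
- exact: closed_compact.
- by exists K, set0; split => //; [exact: clT|exact: cl0|move=> _ ->; exact: AK|
    rewrite setI0].
- by move=> C D CD [G [H [? ? ? DH ?]]]; exists G, H; split => // z /CD/DH.
- move=> C D [G [H [cG cH CG BH GH]]] [G' [H' [cG' cH' DG' BH' GH']]].
  exists (G `&` G'), (H `|` H'); split; [exact: clI|exact: clU| | |].
  + by move=> y xy; split; [exact: CG|exact: DG'].
  + by move=> y [/BH|/BH']; [left|right].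
  + by rewrite setIUr -setIA (setIC G') setIA GH set0I set0U -setIA GH' setI0.
move=> y By.
suff [G [H [cG cH xG yH GH]]] : sep [set x] [set y].
  exists (~` (L `\` H)); split; first exact: clO.
    by move=> -[_]; apply; exact: yH.
  exists G, H; split => // z [nz Bz]; apply: contrapT => nHz; apply: nz.
  by split => //; exact: BL.
have Kx := AK _ Ax; have Ly := BL _ By.
have cK : compact K by exact: closed_compact.
have cL : compact L by exact: closed_compact.
have disj : connected_component K x `<=` ~` connected_component L y.
  move=> z Kz Lz.
  have [KL|LK] := nT (component_continuum hT cK Kx)
    (component_continuum hT cL Ly) (ex_intro _ z (conj Kz Lz)).
    have /KL/connected_component_sub[_ /=] := connected_component_refl Kx.
    by case: Ax => _ /=; lra.
  have /LK/connected_component_sub[_ /=] := connected_component_refl Ly.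
  by case: By => _ /=; lra.
have oL : open (~` connected_component L y).
  by rewrite openC; apply: component_closed.
have [G [cG cKG CG GK GL]] := component_clopen hT cK Kx oL disj.
have oG : open (~` G) by rewrite openC.
have LG : connected_component L y `<=` ~` G by move=> z Lz /GL.
have [H [cH cLH CH HL HG]] := component_clopen hT cL Ly oG LG.
have Gx : G x by apply: CG; exact: connected_component_refl.
have Hy : H y by apply: CH; exact: connected_component_refl.
exists G, H; split => //; try by move=> _ ->.
by apply/seteqP; split => z // [Gz /HG].
Qed.

(** [Y] is crossed in three passes. The clopen sets [G] and [H] are the outer ones; the middle one
    is the rest of [Y], closed up by the points of [G] on level [b2] and those of [H] on level
    [a2]. *)
Lemma crooked_split Y e a1 a2 b1 b2 : closed Y -> continuous e ->
  a1 < a2 -> b2 < b1 -> a1 < b2 -> a2 < b1 ->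
  exists X0 X1 X2 : set T,
    [/\ closed X0, closed X1, closed X2 & Y = X0 `|` X1 `|` X2] /\
    [/\ forall z, X0 z -> e z <= b2, forall z, X1 z -> a1 <= e z <= b1,
        forall z, X2 z -> a2 <= e z, forall z, Y z -> e z <= a1 -> X0 z
      & forall z, Y z -> b1 <= e z -> X2 z] /\
    [/\ forall z, X0 z -> X2 z -> False, forall z, X0 z -> X1 z -> e z = b2
      & forall z, X1 z -> X2 z -> e z = a2].
Proof.
move=> cY ce a12 b21 ab ab'.
have [G [H [[cG cKG GK AG] [cH cLH HL BH GH]]]] :=
  crooked_clopen cY ce a12 b21 (ltW ab) (ltW ab').
pose K := Y `&` [set z | e z <= b2]; pose L := Y `&` [set z | a2 <= e z].
pose X1 := (K `\` G `|` Y `&` [set z | b2 <= e z]) `&`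
           (L `\` H `|` Y `&` [set z | e z <= a2]).
have X1Y z : X1 z -> Y z by move=> [[[[]]|[]]].
have GX1 z : G z -> X1 z -> e z = b2.
  move=> Gz [[[_ /(_ Gz)//]|[_ /= h _]]].
  by have [_ /= h'] := GK _ Gz; apply/eqP; rewrite eq_le h h'.
have HX1 z : H z -> X1 z -> e z = a2.
  move=> Hz [_ [[_ /(_ Hz)//]|[_ /= h]]].
  by have [_ /= h'] := HL _ Hz; apply/eqP; rewrite eq_le h h'.
exists G, X1, H; split; first split => //.
- apply: closedI; apply: closedU => //; apply: closedI => //.
    exact: closed_superlevel.
  exact: closed_sublevel.
- apply/seteqP; split => z; last first.
    by move=> [[/GK[]|/X1Y]|/HL[]].
  move=> Yz; have [Gz|nGz] := pselect (G z); first by left; left.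
  have [Hz|nHz] := pselect (H z); first by right.
  left; right; split.
    have [eb|eb] := leP (e z) b2; [left|right]; split => //=; lra.
  have [eb|eb] := leP a2 (e z); [left|right]; split => //=; lra.
split; last first.
  split => //.
  - by move=> z Gz Hz; have : (G `&` H) z by []; rewrite GH.
  - by move=> z X1z Hz; exact: HX1.
split.
- by move=> z /GK[].
- move=> z X1z; apply/andP; split.
    have [//|ez] := leP a1 (e z).
    have Gz : G z by apply: AG; split; [exact: X1Y|exact: ltW].
    by have := GX1 _ Gz X1z; lra.
  have [//|ez] := leP (e z) b1.
  have Hz : H z by apply: BH; split; [exact: X1Y|exact: ltW].
  by have := HX1 _ Hz X1z; lra.
- by move=> z /HL[].
- by move=> z Yz ez; apply: AG.
- by move=> z Yz ez; apply: BH.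
Qed.

End crooked.

(** * Lifting walks *)

Section lifting.
Context {R : realType} {T : topologicalType}.
Hypotheses (hT : hausdorff_space T) (cT : compact [set: T]).
Hypothesis nT : nested_continua T.
Implicit Types (Y : set T) (e : T -> R) (g : nat -> int).

Definition ascending_walk g i0 i1 :=
  [/\ (i0 <= i1)%N, forall i, (i0 <= i < i1)%N -> `|g i.+1 - g i| <= 1
    & forall i, (i0 <= i <= i1)%N -> g i0 <= g i <= g i1].

(* The sets [D i] are the fibres of a discrete lift [h] of [e] through [g], that
   is, of [h] with [g \o h] within 1 of [e]. *)
Definition walk_cover g i0 i1 (tau : R) Y e (D : nat -> set T) :=
  [/\ forall i, closed (D i),
      forall i z, D i z -> [/\ (i0 <= i <= i1)%N, Y z
        & (g i)%:~R <= e z <= (g i)%:~R + 1],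
      forall z, Y z -> exists i, D i z
    & forall i j z, D i z -> D j z -> (i <= j.+1)%N] /\
  [/\ forall i z, D i z -> e z <= (g i0)%:~R + tau -> i = i0
    & forall i z, D i z -> (g i1)%:~R + 1 - tau <= e z -> i = i1].

Definition walk_liftable g i0 i1 := forall tau Y e,
  0 <= tau -> tau < 2^-1 -> closed Y -> continuous e ->
  (forall z, Y z -> (g i0)%:~R <= e z <= (g i1)%:~R + 1) ->
  exists D, walk_cover g i0 i1 tau Y e D.

(** Descending stretches become ascending ones for [- e]: negation carries the unit interval
    starting at [g i] to the one starting at [- g i - 1]. *)
Let mirror g : nat -> int := fun i => - g i - 1.

(** The pieces of [crooked_split], cut near the levels [g r] and [g p + 1], are lifted through the
    three legs of the walk. Where two pieces meet, the end clauses of [walk_cover] put both lifts at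
    the common turning time [p] or [r], so the glued lift still moves by single steps. *)
Lemma walk_liftable_fold g i0 p r i1 :
  ascending_walk g i0 i1 -> (i0 <= p)%N -> (p <= r)%N -> (r <= i1)%N ->
  g r <= g p ->
  walk_liftable g i0 p -> walk_liftable (mirror g) p r ->
  walk_liftable g r i1 -> walk_liftable g i0 i1.
Proof.
move=> [i01 _ gb] i0p pr ri1 grp L0 L1 L2 tau Y e tau0 tau2 cY ce eY.
(* The strict inequality [tau < s] keeps apart the pairs of levels required for the split; the legs
   are lifted with tolerance [s], so that their end clauses hold on the cut levels. *)
pose s : R := (tau + 2^-1) / 2.
have [s0 s2 ts] : [/\ 0 <= s, s < 2^-1 & tau < s] by rewrite /s; split; lra.
clearbody s.
have gr : (g r)%:~R <= (g p)%:~R :> R by rewrite ler_int.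
clear grp.
have g0r : (g i0)%:~R <= (g r)%:~R :> R.
  by rewrite ler_int; have /andP[] := gb r ltac:(lia).
have gp1 : (g p)%:~R <= (g i1)%:~R :> R.
  by rewrite ler_int; have /andP[] := gb p ltac:(lia).
have [X0 [X1 [X2 [[c0 c1 c2 YE] [[X0e X1e X2e eX0 eX2] [X02 X01 X12]]]]]] :=
  @crooked_split R T hT cT nT Y e ((g r)%:~R + tau) ((g r)%:~R + s)
   ((g p)%:~R + 1 - tau) ((g p)%:~R + 1 - s) cY ce
   ltac:(lra) ltac:(lra) ltac:(lra) ltac:(lra).
have wid0 i : (i0 <= i <= p)%N -> (i0 <= i <= i1)%N by clear -pr ri1; lia.
have wid1 i : (p <= i <= r)%N -> (i0 <= i <= i1)%N by clear -i0p ri1; lia.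
have wid2 i : (r <= i <= i1)%N -> (i0 <= i <= i1)%N by clear -i0p pr; lia.
have X0Y z : X0 z -> Y z by rewrite YE; left; left.
have X1Y z : X1 z -> Y z by rewrite YE; left; right.
have X2Y z : X2 z -> Y z by rewrite YE; right.
have [D0 [[cD0 D0e D0c D0a] [D0l D0u]]] : exists D, walk_cover g i0 p s X0 e D.
  apply: L0 => // z X0z; have := X0e _ X0z; have := eY _ (X0Y _ X0z); lra.
have [D2 [[cD2 D2e D2c D2a] [D2l D2u]]] : exists D, walk_cover g r i1 s X2 e D.
  apply: L2 => // z X2z; have := X2e _ X2z; have := eY _ (X2Y _ X2z); lra.
have mE i : (mirror g i)%:~R = - (g i)%:~R - 1 :> R.
  by rewrite /mirror intrB mulrNz mulr1z.
have [D1 [[cD1 D1e D1c D1a] [D1l D1u]]] :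
    exists D, walk_cover (mirror g) p r s X1 (fun z => - e z) D.
  apply: L1 => //; first exact: opp_fun_continuous.
  by move=> z X1z; have := X1e _ X1z; rewrite !mE; lra.
have D01 i j z : D0 i z -> D1 j z -> i = p /\ j = p.
  move=> D0z D1z; have [_ X0z _] := D0e _ _ D0z; have [_ X1z _] := D1e _ _ D1z.
  have ez := X01 _ X0z X1z; split; first by apply: D0u D0z _; lra.
  by apply: D1l D1z _; rewrite mE; lra.
have D12 i j z : D1 i z -> D2 j z -> i = r /\ j = r.
  move=> D1z D2z; have [_ X1z _] := D1e _ _ D1z; have [_ X2z _] := D2e _ _ D2z.
  have ez := X12 _ X1z X2z; split; last by apply: D2l D2z _; lra.
  by apply: D1u D1z _; rewrite mE; lra.
have D02 i j z : D0 i z -> D2 j z -> False.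
  move=> D0z D2z; have [_ X0z _] := D0e _ _ D0z; have [_ X2z _] := D2e _ _ D2z.
  exact: X02 X0z X2z.
exists (fun i => D0 i `|` D1 i `|` D2 i); split; split.
- by move=> i; do 2?apply: closedU.
- move=> i z [[Dz|Dz]|Dz].
  + have [ii X0z ez] := D0e _ _ Dz; split => //; [exact: wid0|exact: X0Y].
  + have [ii X1z] := D1e _ _ Dz; rewrite mE => ez.
    by split; [exact: wid1|exact: X1Y|lra].
  + have [ii X2z ez] := D2e _ _ Dz; split => //; [exact: wid2|exact: X2Y].
- move=> z; rewrite YE => -[[/D0c|/D1c]|/D2c] [i Di]; exists i.
  + by left; left.
  + by left; right.
  + by right.
- move=> i j z [[Di|Di]|Di] [[Dj|Dj]|Dj].
  + exact: D0a Di Dj.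
  + by have [-> ->] := D01 _ _ _ Di Dj.
  + by have := D02 _ _ _ Di Dj.
  + by have [-> ->] := D01 _ _ _ Dj Di.
  + exact: D1a Di Dj.
  + by have [-> ->] := D12 _ _ _ Di Dj.
  + by have := D02 _ _ _ Dj Di.
  + by have [-> ->] := D12 _ _ _ Dj Di.
  + exact: D2a Di Dj.
- move=> i z Dz ez.
  have Yz : Y z.
    by case: Dz => [[/D0e[_ /X0Y]|/D1e[_ /X1Y]]|/D2e[_ /X2Y]].
  have X0z : X0 z by apply: eX0 => //; lra.
  case: Dz => [[Dz|Dz]|Dz].
  + by apply: D0l Dz _; lra.
  + by have [_ X1z _] := D1e _ _ Dz; have h := X01 _ X0z X1z; exfalso; lra.
  + by have [_ X2z _] := D2e _ _ Dz; have := X02 _ X0z X2z.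
- move=> i z Dz ez.
  have Yz : Y z.
    by case: Dz => [[/D0e[_ /X0Y]|/D1e[_ /X1Y]]|/D2e[_ /X2Y]].
  have X2z : X2 z by apply: eX2 => //; lra.
  case: Dz => [[Dz|Dz]|Dz].
  + by have [_ X0z _] := D0e _ _ Dz; have := X02 _ X0z X2z.
  + by have [_ X1z _] := D1e _ _ Dz; have h := X12 _ X1z X2z; exfalso; lra.
  + by apply: D2u Dz _; lra.
Qed.

(** The lowest and highest unit bands of [Y] are given to the end times [i0] and [i1], the rest to
    the shortened walk. On the common levels its end clauses force the first or last inner time,
    which is adjacent to the end time. *)
Lemma walk_liftable_trim g i0 i1 : (i0.+1 < i1)%N -> g i0 + 1 < g i1 ->
  g i0.+1 = g i0 + 1 -> g i1.-1 = g i1 - 1 ->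
  walk_liftable g i0.+1 i1.-1 -> walk_liftable g i0 i1.
Proof.
move=> i01 g01 g0E g1E L tau Y e tau0 tau2 cY ce eY.
have g01' : (g i0)%:~R + 1 < (g i1)%:~R :> R.
  by rewrite -[1](@mulr1z R) -intrD ltr_int.
have g0E' : (g i0.+1)%:~R = (g i0)%:~R + 1 :> R by rewrite g0E intrD mulr1z.
have g1E' : (g i1.-1)%:~R = (g i1)%:~R - 1 :> R by rewrite g1E intrB mulr1z.
clear g01 g0E g1E.
pose Ylo := Y `&` [set z | e z <= (g i0)%:~R + 1].
pose Yhi := Y `&` [set z | (g i1)%:~R <= e z].
pose Y' := Y `&` [set z | (g i0)%:~R + 1 <= e z] `&` [set z | e z <= (g i1)%:~R].
have cYlo : closed Ylo by apply: closedI => //; exact: closed_sublevel.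
have cYhi : closed Yhi by apply: closedI => //; exact: closed_superlevel.
have cY' : closed Y'.
  apply: closedI; last exact: closed_sublevel.
  by apply: closedI => //; exact: closed_superlevel.
have [D [[cD De Dc Da] [Dl Du]]] :
    exists D, walk_cover g i0.+1 i1.-1 tau Y' e D.
  by apply: L => // z [[Yz /= e0] /= e1]; rewrite g0E' g1E'; lra.
have i10 : i1 != i0 by lia.
have Dlo j z : D j z -> e z <= (g i0)%:~R + 1 -> j = i0.+1.
  by move=> Dz ez; apply: Dl Dz _; rewrite g0E'; lra.
have Dhi j z : D j z -> (g i1)%:~R <= e z -> j = i1.-1.
  by move=> Dz ez; apply: Du Dz _; rewrite g1E'; lra.
have DY' j z : D j z -> [/\ (i0 < j < i1)%N, Y z, (g i0)%:~R + 1 <= e z,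
    e z <= (g i1)%:~R & (g j)%:~R <= e z <= (g j)%:~R + 1].
  move=> /De[jj [[Yz /= e0] /= e1] ej]; split => //.
  by clear -jj i01; lia.
have lohi z : Ylo z -> Yhi z -> False by move=> [_ /= ?] [_ /= ?]; lra.
pose E i := if i == i0 then Ylo else if i == i1 then Yhi else D i.
have EP i z : E i z -> [\/ i = i0 /\ Ylo z, i = i1 /\ Yhi z | D i z].
  rewrite /E; case: eqP => [->|_]; first by move=> h; apply: Or31.
  by case: eqP => [->|_] h; [apply: Or32|apply: Or33].
have E0 : E i0 = Ylo by rewrite /E eqxx.
have E1 : E i1 = Yhi by rewrite /E eqxx (negbTE i10).
have DE i z : D i z -> E i z.
  move=> Dz; have [ii _ _ _ _] := DY' _ _ Dz.
  rewrite /E; case: eqP => [h|_]; first by move: ii; rewrite h ltnn.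
  by case: eqP => [h|_] //; move: ii; rewrite h ltnn andbF.
exists E; split; split.
- by move=> i; rewrite /E; case: eqP => // _; case: eqP.
- move=> i z /EP[[-> [Yz /= ez]]|[-> [Yz /= ez]]|/DY'[ii Yz _ _ ez]].
  + by split => //; [clear -i01; lia|have := eY _ Yz; lra].
  + by split => //; [clear -i01; lia|have := eY _ Yz; lra].
  + by split => //; clear -ii; lia.
- move=> z Yz; have [ez|ez] := leP (e z) ((g i0)%:~R + 1).
    by exists i0; rewrite E0.
  have [ez'|ez'] := leP (g i1)%:~R (e z); first by exists i1; rewrite E1.
  have [|j Dj] := Dc z; last by exists j; exact: DE.
  by split; [split => //=; lra|rewrite /=; lra].
- move=> i j z /EP[[-> zlo]|[-> zhi]|Di] /EP[[-> zlo']|[-> zhi']|Dj] //.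
  + by case: (lohi _ zlo zhi').
  + by have [/andP[]] := DY' _ _ Dj; clear; lia.
  + by case: (lohi _ zlo' zhi).
  + by case: zhi => _ /= zhi; rewrite (Dhi _ _ Dj zhi); clear; lia.
  + by case: zlo' => _ /= zlo'; rewrite (Dlo _ _ Di zlo').
  + by have [/andP[]] := DY' _ _ Di; clear; lia.
  + exact: Da Di Dj.
- by move=> i z /EP[[-> //]|[-> [_ /= ?]]|/DY'[_ _ ? _ _]] ?; exfalso; lra.
- by move=> i z /EP[[-> [_ /= ?]]|[-> //]|/DY'[_ _ _ ? _]] ?; exfalso; lra.
Qed.

Lemma walk_liftable_step g i : `|g i.+1 - g i| <= 1 -> g i <= g i.+1 ->
  walk_liftable g i i.+1.
Proof.
move=> g1 g01 tau Y e tau0 tau2 cY ce eY.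
have g01' : (g i)%:~R <= (g i.+1)%:~R :> R by rewrite ler_int.
have g1' : (g i.+1)%:~R <= (g i)%:~R + 1 :> R.
  by rewrite -[1](@mulr1z R) -intrD ler_int; lia.
clear g1 g01.
(* The midpoint of the range allowed for [e], at distance at least 1/2 from both ends; as [tau] is
   below 1/2, the points near an end fall on one side only. *)
pose c : R := ((g i)%:~R + (g i.+1)%:~R + 1) / 2.
have [c1 c2] : (g i)%:~R + 2^-1 <= c <= (g i)%:~R + 1 /\
    (g i.+1)%:~R <= c <= (g i.+1)%:~R + 2^-1 by rewrite /c; split; lra.
pose Ylo := Y `&` [set z | e z <= c]; pose Yhi := Y `&` [set z | c <= e z].
pose D j := if j == i then Ylo else if j == i.+1 then Yhi else set0.
have DP j z : D j z -> j = i /\ Ylo z \/ j = i.+1 /\ Yhi z.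
  rewrite /D; case: eqP => [->|_]; first by left.
  by case: eqP => [->|_]; first by right.
exists D; split; split.
- move=> j; rewrite /D; case: eqP => [_|_].
    by apply: closedI => //; exact: closed_sublevel.
  case: eqP => [_|_]; last exact: closed0.
  by apply: closedI => //; exact: closed_superlevel.
- move=> j z /DP[[-> [Yz /= ez]]|[-> [Yz /= ez]]];
    (split => //; first by clear; lia); have := eY _ Yz; lra.
- move=> z Yz; have [ez|ez] := leP (e z) c.
    by exists i; rewrite /D eqxx.
  exists i.+1; rewrite /D eqxx (_ : i.+1 == i = false); last by clear; lia.
  by split => //=; lra.
- by move=> j k z /DP[[-> _]|[-> _]] /DP[[-> _]|[-> _]]; clear; lia.
- by move=> j z /DP[[-> //]|[-> [_ /= ?]]] ?; exfalso; lra.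
- by move=> j z /DP[[-> [_ /= ?]]|[-> //]] ?; exfalso; lra.
Qed.

Lemma walk_liftable_const g i : walk_liftable g i i.
Proof.
move=> tau Y e tau0 tau2 cY ce eY.
pose D j := if j == i then Y else set0.
have DP j z : D j z -> j = i /\ Y z by rewrite /D; case: eqP.
exists D; split; split.
- by move=> j; rewrite /D; case: eqP => // _; exact: closed0.
- by move=> j z /DP[-> Yz]; rewrite leqnn; split => //; exact: eY.
- by move=> z Yz; exists i; rewrite /D eqxx.
- by move=> j k z /DP[-> _] /DP[-> _].
- by move=> j z /DP[].
- by move=> j z /DP[].
Qed.

Lemma interval_argmin g a b : (a <= b)%N ->
  exists s, (a <= s <= b)%N /\ forall i, (a <= i <= b)%N -> g s <= g i.
Proof.
move=> ab; have : exists k, b = (a + k)%N by exists (b - a)%N; rewrite subnKC.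
move=> [k ->]; elim: k => [|k [s [sab smin]]].
  by exists a; split => [|i]; [lia|move=> ?; rewrite (_ : i = a)//; lia].
have [gs|gs] := leP (g s) (g (a + k.+1)%N).
  exists s; split => [|i ii]; first by clear -sab; lia.
  have [->//|h] := eqVneq i (a + k.+1)%N.
  by apply: smin; clear -ii h; lia.
exists (a + k.+1)%N; split => [|i ii]; first by clear; lia.
have [->//|h] := eqVneq i (a + k.+1)%N.
apply: (le_trans (ltW gs)); apply: smin; clear -ii h; lia.
Qed.

(* If the walk returns to its maximum or minimum at an interior time, it splits
   into three shorter walks (up, down, up); otherwise both ends can be trimmed. *)
Lemma ascending_walk_liftable g i0 i1 :
  ascending_walk g i0 i1 -> walk_liftable g i0 i1.
Proof.
have [n] := ubnP (i1 - i0); elim: n => // n IH in g i0 i1 *.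
rewrite ltnS => in01 asc; have [i01 step gb] := asc.
have [->|i0n1] := eqVneq i0 i1; first exact: walk_liftable_const.
have [i1E|i1E] := eqVneq i0.+1 i1.
  rewrite -i1E; apply: walk_liftable_step; first by apply: step; lia.
  by have /andP[] := gb i0.+1 ltac:(lia).
have mid t : (i0 < t < i1)%N -> g i0 <= g t <= g i1 by move=> ?; apply: gb; lia.
have [[t tt gt]|nmax] := pselect (exists2 t, (i0 < t < i1)%N & g t = g i1).
  (* Cutting at [t], a return to the maximum, and at a lowest time [r] after it keeps each leg
     between its own end values. *)
  have [r [tr rmin]] := @interval_argmin g t i1 ltac:(lia).
  apply: (@walk_liftable_fold g i0 t r i1 asc); try lia.
  - by apply: rmin; lia.
  - apply: IH; first lia.
    by split => [|i ii|i ii]; [lia|apply: step; lia|rewrite gt; apply: gb; lia].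
  - apply: IH; first lia.
    split => [|i ii|i ii]; [lia| |].
      by rewrite /mirror; have := step i ltac:(lia); lia.
    have := gb i ltac:(lia); have := rmin i ltac:(lia); rewrite /mirror gt; lia.
  - apply: IH; first lia.
    split => [|i ii|i ii]; [lia|apply: step; lia|].
    have := gb i ltac:(lia); have := rmin i ltac:(lia); lia.
have [[t tt gt]|nmin] := pselect (exists2 t, (i0 < t < i1)%N & g t = g i0).
  have [p [tp pmin]] := @interval_argmin (mirror g) i0 t ltac:(lia).
  have pmax i : (i0 <= i <= t)%N -> g i <= g p.
    by move=> /pmin; rewrite /mirror; lia.
  apply: (@walk_liftable_fold g i0 p t i1 asc); try lia.
  - by apply: pmax; lia.
  - apply: IH; first lia.
    split => [|i ii|i ii]; [lia|apply: step; lia|].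
    have := gb i ltac:(lia); have := pmax i ltac:(lia); lia.
  - apply: IH; first lia.
    split => [|i ii|i ii]; [lia| |].
      by rewrite /mirror; have := step i ltac:(lia); lia.
    have := gb i ltac:(lia); have := pmax i ltac:(lia); rewrite /mirror gt; lia.
  - apply: IH; first lia.
    by split => [|i ii|i ii]; [lia|apply: step; lia|rewrite gt; apply: gb; lia].
have strict t : (i0 < t < i1)%N -> g i0 < g t < g i1.
  move=> tt; have := mid t tt.
  have : g t <> g i1 by move=> h; apply: nmax; exists t.
  have : g t <> g i0 by move=> h; apply: nmin; exists t.
  clear; lia.
have s0 := strict i0.+1 ltac:(lia); have s1 := strict i1.-1 ltac:(lia).
have st0 := step i0 ltac:(lia).
have st1 : `|g i1 - g i1.-1| <= 1.
  by have := step i1.-1 ltac:(lia); rewrite prednK //; lia.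
apply: walk_liftable_trim; try lia.
apply: IH; first lia.
split => [|i ii|i ii]; [lia|apply: step; lia|].
have := strict i ltac:(lia); lia.
Qed.

End lifting.

(** * Every point is an end point *)

Lemma glue_continuous (T U : topologicalType) (G : set T) (f g : T -> U) :
  closed G -> continuous f -> continuous g ->
  (forall z, G z -> closure (~` G) z -> f z = g z) ->
  continuous (fun z => if `[< G z >] then f z else g z).
Proof.
move=> cG /continuous_closedP cf /continuous_closedP cg fg.
apply/continuous_closedP => A cA.
rewrite (_ : _ @^-1` A = G `&` f @^-1` A `|` closure (~` G) `&` g @^-1` A).
  apply: closedU; apply: closedI; [by []|exact: cf| |exact: cg].
  exact: closed_closure.
apply/seteqP; split => z /=.
  case: asboolP => Gz Az; first by left.
  by right; split => //; exact: subset_closure.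
move=> [[Gz fz]|[nGz gz]]; case: asboolP => // Gz'.
by rewrite /= (fg _ Gz' nGz).
Qed.

Section endpoint.
Context {R : realType} {T : topologicalType}.
Hypotheses (hT : hausdorff_space T) (cT : compact [set: T]).
Hypothesis nT : nested_continua T.
Implicit Types (q e : T -> R) (G O : set T).

(* [G] is attached to the rest of the space along the level [q = b], which is
   where the unfolded coordinate [e] attains its final value [L]. *)
Definition end_chart q (b : R) G e (L : R) :=
  [/\ closed G, continuous e, 0 <= L, forall z, G z -> 0 <= e z
    & forall z, G z -> closure (~` G) z -> q z = b /\ e z = L] /\
  [/\ forall z w, G z -> G w -> `|q z - q w| <= `|e z - e w| + 4
    & forall z, G z -> `|q z - b| <= L - e z + 2].

Lemma end_chart_opp q b G e L :
  end_chart (fun z => - q z) (- b) G e L -> end_chart q b G e L.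
Proof.
move=> [[cG ce L0 e0 bG] [qe qb]]; split; split => //.
- move=> z Gz nGz; have [/eqP + ->] := bG z Gz nGz.
  by rewrite eqr_opp => /eqP ->.
- by move=> z w Gz Gw; have := qe z w Gz Gw; rewrite -opprD normrN.
- by move=> z Gz; have := qb z Gz; rewrite -opprD normrN.
Qed.

(** Every point outside [G] lies in the closed set made of the rest of [[q <= b]] and of [[b <= q]];
    this set can meet [G] only where [q = b]. *)
Lemma sublevel_clopen_boundary q b G : continuous q ->
  closed ([set z | q z <= b] `\` G) -> (forall z, G z -> q z <= b) ->
  forall z, G z -> closure (~` G) z -> q z = b.
Proof.
move=> cq cqG Gq z Gz nGz; apply/eqP; rewrite eq_le Gq //=.
have : closed ([set z | q z <= b] `\` G `|` [set z | b <= q z]).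
  by apply: closedU => //; exact: closed_superlevel.
move=> /closure_id cE.
have : closure ([set z | q z <= b] `\` G `|` [set z | b <= q z]) z.
  apply: closureS nGz => w nGw.
  by have [h|h] := leP (q w) b; [left|right; exact: ltW].
by rewrite -cE => -[[_ /(_ Gz)]|].
Qed.

(** One more arm of the spiral: [G0] is run through from level [a] up to [b], continuing the
    coordinate from [L] by the rise of [q] above [a]. Dips of [q] below [a] on [G0] are at most 2
    and are flattened; together with the error 2 allowed on [G] this gives the 4 of [end_chart]. *)
Lemma end_chart_leg q a b G e L G0 : continuous q -> end_chart q a G e L ->
  a < b -> closed G0 -> closed ([set z | q z <= b] `\` G0) ->
  (forall z, G0 z -> a - 2 <= q z <= b) ->
  (forall z, G z -> q z <= b -> G0 z) ->
  exists e' L', [/\ end_chart q b (G `|` G0) e' L',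
    forall z, G z -> e' z = e z
    & forall z, ~ G z -> e' z = L + Num.max (q z - a) 0].
Proof.
move=> cq [[cG ce L0 e0 bG] [qe qa]] ab cG0 cqG0 G0q GG0.
pose leg z := L + Num.max (q z - a) 0.
have cleg : continuous leg.
  apply: add_fun_continuous; first exact: cst_continuous.
  apply: max_fun_continuous; last exact: cst_continuous.
  by apply: add_fun_continuous => //; exact: cst_continuous.
have legE z : (leg z = L + (q z - a) /\ a <= q z) \/ (leg z = L /\ q z <= a).
  rewrite /leg; have [h|h] := leP (q z - a) 0; [right|left]; split; lra.
pose e' z := if `[< G z >] then e z else leg z.
have e'G z : G z -> e' z = e z by rewrite /e'; case: asboolP.
have e'N z : ~ G z -> e' z = leg z by rewrite /e'; case: asboolP.
have ce' : continuous e'.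
  apply: glue_continuous => // z Gz nGz; have [qz ->] := bG z Gz nGz.
  by rewrite /leg qz subrr maxxx addr0.
clearbody e'.
have G0leg z : G0 z -> [\/ leg z = L + (q z - a) /\ a <= q z <= b |
    leg z = L /\ a - 2 <= q z <= a].
  move=> /G0q qz; have [[lz az]|[lz az]] := legE z; [left|right]; split => //; lra.
have GUP z : (G `|` G0) z -> G z /\ e' z = e z \/
    ~ G z /\ e' z = leg z /\ G0 z.
  have [Gz _|nGz [//|G0z]] := pselect (G z); first by left; rewrite e'G.
  by right; rewrite e'N.
exists e', (L + (b - a)); split => //; split; split => //.
- exact: closedU.
- lra.
- move=> z /GUP[[Gz ->]|[_ [-> G0z]]]; first exact: e0.
  have [[-> ?]|[-> ?]] := G0leg _ G0z; lra.
- move=> z GGz nGGz.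
  have nGz : closure (~` G) z.
    by apply: closureS nGGz => w; rewrite setCU => -[].
  have nG0z : closure (~` G0) z.
    by apply: closureS nGGz => w; rewrite setCU => -[].
  have [qb|qb] := leP (q z) b; last first.
    case: GGz => [Gz|/G0q]; last lra.
    by have [qz _] := bG _ Gz nGz; lra.
  have G0z : G0 z by case: GGz => // Gz; exact: GG0.
  have qzb : q z = b.
    apply: (sublevel_clopen_boundary cq cqG0) => // w /G0q; lra.
  split => //.
  have [Gz|nGz'] := pselect (G z).
    by have [qz _] := bG _ Gz nGz; lra.
  by rewrite e'N //; have [[-> _]|[_ ?]] := legE z; lra.
- have mixed z w : G z -> G0 w -> `|q z - q w| <= `|e z - leg w| + 4.
    move=> Gz G0w; have h := qa _ Gz.
    have h1 : `|q z - q w| <= `|q z - a| + `|a - q w|.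
      by rewrite -(subrKA a); exact: ler_normD.
    have h2 : `|a - q w| <= leg w - L + 2.
      have [[-> ?]|[-> ?]] := G0leg _ G0w; rewrite ler_norml; lra.
    have h3 : leg w - e z <= `|e z - leg w| by rewrite distrC ler_norm.
    lra.
  move=> z w /GUP[[Gz ->]|[_ [-> G0z]]] /GUP[[Gw ->]|[_ [-> G0w]]].
  + exact: qe.
  + exact: mixed.
  + by rewrite distrC [X in _ <= X + _]distrC; exact: mixed.
  + have h : leg z - leg w <= `|leg z - leg w| by rewrite ler_norm.
    have h' : leg w - leg z <= `|leg z - leg w| by rewrite distrC ler_norm.
    rewrite ler_norml.
    have [[hz ?]|[hz ?]] := G0leg _ G0z; have [[hw ?]|[hw ?]] := G0leg _ G0w;
      rewrite hz hw in h h' *; lra.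
- move=> z /GUP[[Gz ->]|[_ [-> G0z]]].
    have h := qa _ Gz.
    have h1 : `|q z - b| <= `|q z - a| + `|a - b|.
      by rewrite -(subrKA a); exact: ler_normD.
    by move: h1; rewrite [`|a - b|]distrC [`|b - a|]ger0_norm; lra.
  rewrite ler_norml; have [[-> ?]|[-> ?]] := G0leg _ G0z; lra.
Qed.

Lemma end_chart_set0 q a : end_chart q a set0 (cst 0) 0.
Proof.
by split; split => //; [exact: closed0|exact: cst_continuous].
Qed.

Let closed_compact (Y : set T) : closed Y -> compact Y.
Proof. by move=> cY; exact: (subclosed_compact cY cT). Qed.

Lemma end_chart_flat q a b G : continuous q -> b - a <= 2 -> closed G ->
  closed ([set z | q z <= b] `\` G) -> (forall z, G z -> a < q z <= b) ->
  end_chart q b G (cst 0) 0.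
Proof.
move=> cq ba2 cG cqG Gq; split; split => //; first exact: cst_continuous.
- move=> z Gz nGz; split => //.
  by apply: (sublevel_clopen_boundary cq cqG) => // w /Gq; lra.
- by move=> z w /Gq ? /Gq ?; rewrite /cst /= subrr normr0 ler_norml; lra.
- by move=> z /Gq ?; rewrite ler_norml /cst /=; lra.
Qed.

Lemma sublevel_clopen q a b x O : continuous q -> q x <= b -> open O ->
  connected_component [set z | q z <= b] x `<=` [set z | a < q z] ->
  connected_component [set z | q z <= b] x `<=` O ->
  exists G, [/\ closed G, closed ([set z | q z <= b] `\` G),
    connected_component [set z | q z <= b] x `<=` G,
    forall z, G z -> a < q z <= b & G `<=` O].
Proof.
move=> cq qxb oO la lO.
have cK : compact [set z | q z <= b].
  by apply: closed_compact; exact: closed_sublevel.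
have oO' : open (O `&` [set z | a < q z]).
  by apply: openI => //; exact: open_superlevel.
have lO' : connected_component [set z | q z <= b] x `<=`
    O `&` [set z | a < q z].
  by move=> z lz; split; [exact: lO|exact: la].
have [G [cG cbG lG Gb GO]] := component_clopen hT cK qxb oO' lO'.
exists G; split => //; last by move=> z /GO[].
by move=> z Gz; have [_ /= ->] := GO z Gz; exact: Gb.
Qed.

(* Nested components of [x] in [q <= b] and [a <= q] alternate outwards from [x];
   following them unfolds [q] into a spiral starting at [x]. *)
Lemma end_chart_exists n q a b x O : continuous q -> b - a <= n%:R / 2 + 2 ->
  q x <= b -> open O ->
  connected_component [set z | q z <= b] x `<=` [set z | a < q z] ->
  connected_component [set z | q z <= b] x `<=` O ->
  exists G e L, [/\ end_chart q b G e L, G x, e x = 0 & G `<=` O].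
Proof.
elim: n q a b O => [|n IH] q a b O cq ban qxb oO la lO.
  have [G [cG cbG lG Gq GO]] := sublevel_clopen cq qxb oO la lO.
  exists G, (cst 0), 0; split => //; last first.
    by apply: lG; exact: connected_component_refl.
  by apply: (end_chart_flat cq _ cG cbG Gq); move: ban; rewrite mul0r add0r.
have oO' : open (O `&` [set z | q z < b + 1]).
  by apply: openI => //; exact: open_sublevel.
have lO' : connected_component [set z | q z <= b] x `<=`
    O `&` [set z | q z < b + 1].
  move=> z lz; split; first exact: lO.
  by have /= := connected_component_sub lz; lra.
have [G0 [cG0 cbG0 lG0 G0q G0O]] := sublevel_clopen cq qxb oO' la lO'.
have G0x : G0 x by apply: lG0; exact: connected_component_refl.
have [ba2|ba2] := leP (b - a) 2.
  exists G0, (cst 0), 0; split => //; last by move=> z /G0O[].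
  exact: (end_chart_flat cq ba2 cG0 cbG0 G0q).
(* When the component stays half a unit above [a], the band is narrowed. Otherwise it has a point
   [y] within 1/2 of level [a]; if [x] itself is within 1 of [a], a single arm added to the empty
   chart is enough. *)
have [la1|/existsNP[y /not_implyP[ly /= qy]]] :=
    pselect (connected_component [set z | q z <= b] x `<=`
      [set z | a + 2^-1 < q z]).
  by apply: (IH q (a + 2^-1) b O) => //; move: ban; rewrite -natr1; lra.
have ab1 : a + 1 < b by lra.
have [qxa|qxa] := leP (q x) (a + 1).
  have [||e' [L' [ch _ e'E]]] :=
    end_chart_leg cq (end_chart_set0 q (a + 1)) ab1 cG0 cbG0.
  - by move=> z /G0q; lra.
  - by [].
  exists (set0 `|` G0), e', L'; rewrite set0U in ch *; split => //.
    by rewrite e'E //; have [] := leP (q x - (a + 1)) 0; lra.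
  by move=> z /G0O[].
have kx : [set z | a + 1 <= q z] x by exact: ltW.
pose kap := connected_component [set z | a + 1 <= q z] x.
have kapx : kap x by exact: connected_component_refl.
have ckap : continuum kap.
  by apply: component_continuum => //; apply: closed_compact; exact: closed_superlevel.
have clam c : q x <= c -> continuum (connected_component [set z | q z <= c] x).
  by move=> ?; apply: component_continuum => //; apply: closed_compact; exact: closed_sublevel.
have lamx c : q x <= c -> connected_component [set z | q z <= c] x x.
  by move=> ?; exact: connected_component_refl.
(* [y] lies below level [a + 1], so of the two nested components [kap] is the smaller. *)
have kl : kap `<=` connected_component [set z | q z <= b] x.
  have [lk|//] := nT (clam b qxb) ckap (ex_intro _ x (conj (lamx _ qxb) kapx)).
  by have /lk/connected_component_sub /= := ly; lra.
(* Within [[q <= b]] this neighbourhood of [kap] is contained in [G0], as [end_chart_leg] demands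
   when [G0] is attached to the inner chart. *)
pose O2 := O `&` [set z | q z < b + 1] `&` ~` ([set z | q z <= b] `\` G0).
have oO2 : open O2 by apply: openI => //; rewrite openC.
have kO2 : kap `<=` O2.
  by move=> z /kl lz; split; [exact: lO'|move=> [_]; apply; exact: lG0].
have cnq : continuous (fun z => - q z) by exact: opp_fun_continuous.
have nqE c : [set z | - q z <= - c] = [set z | c <= q z].
  by apply/seteqP; split => z /=; rewrite lerN2.
suff [G [e [L [ch Gx ex GO2]]]] : exists G e L,
    [/\ end_chart (fun z => - q z) (- (a + 1)) G e L, G x, e x = 0 & G `<=` O2].
  have [||e' [L' [ch' e'E _]]] :=
    end_chart_leg cq (end_chart_opp ch) ab1 cG0 cbG0.
  - by move=> z /G0q; lra.
  - move=> z /GO2[_ nz] qz; apply: contrapT => nG0z; exact: nz.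
  exists (G `|` G0), e', L'; split => //; [by left|by rewrite e'E|].
  by move=> z [/GO2[[]]|/G0O[]].
have [kb|/existsNP[w /not_implyP[kw /= qw]]] :=
    pselect (kap `<=` [set z | q z < b - 2^-1]).
  apply: (IH _ (- (b - 2^-1))) => //.
  - by move: ban; rewrite -natr1; lra.
  - by rewrite lerN2.
  - by rewrite nqE => z /kb /=; rewrite ltrN2.
  - by rewrite nqE.
have [G1 [cG1 cbG1 kG1 G1a G1O]] :=
  component_clopen hT (closed_compact (closed_superlevel cq)) kx oO2 kO2.
rewrite -nqE in cbG1.
have G1q z : G1 z -> - (b - 1) - 2 <= - q z <= - (a + 1).
  by move=> G1z; have [[_ /= qz] _] := G1O z G1z; have /= := G1a z G1z; lra.
have ba1 : - (b - 1) < - (a + 1) by lra.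
have [qxb1|qxb1] := leP (b - 1) (q x).
  have [|e' [L' [ch _ e'E]]] := end_chart_leg cnq
    (end_chart_set0 (fun z => - q z) (- (b - 1))) ba1 cG1 cbG1 G1q.
  - by [].
  exists (set0 `|` G1), e', L'; rewrite set0U in ch *; split => //.
    exact: kG1.
  by rewrite e'E //; have [] := leP (- q x - - (b - 1)) 0; lra.
(* The point [w] above level [b - 1] makes the next component inwards smaller than [kap]. The band
   has shrunk by 1, and the arms [G1] and then [G0] are added to the chart of the inner band. *)
have lk : connected_component [set z | q z <= b - 1] x `<=` kap.
  have [//|kl1] := nT (clam (b - 1) (ltW qxb1)) ckap
    (ex_intro _ x (conj (lamx _ (ltW qxb1)) kapx)).
  by have /kl1/connected_component_sub /= := kw; lra.
have [|||||G3 [e3 [L3 [ch3 G3x e3x G3O]]]] :=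
  IH q a (b - 1) (O2 `&` ~` ([set z | - q z <= - (a + 1)] `\` G1)) cq.
- by move: ban; rewrite -natr1; lra.
- exact: ltW.
- by apply: openI => //; rewrite openC.
- by move=> z /lk/connected_component_sub /=; lra.
- move=> z /lk kz; split; first exact: kO2.
  by move=> [_]; apply; exact: kG1.
have ch3' : end_chart (fun z => - q z) (- (b - 1)) G3 e3 L3.
  by apply: end_chart_opp; under eq_fun do rewrite opprK; rewrite opprK.
have [|e' [L' [ch' e'E _]]] := end_chart_leg cnq ch3' ba1 cG1 cbG1 G1q.
- by move=> z /G3O[_ nz] qz; apply: contrapT => nG1z; exact: nz.
exists (G3 `|` G1), e', L'; split => //; [by left|by rewrite e'E|].
by move=> z [/G3O[]|/G1O].
Qed.

(** The band from [- N - 1] to [N + 1] strictly contains the range of [q], so the chart has no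
    boundary and fills the connected space. Its minimum 0 at [x] exhibits [x] as an end point. *)
Lemma endpoint_chart q x : connected [set: T] -> continuous q ->
  exists e, [/\ continuous e, forall z, 0 <= e z, e x = 0
    & forall z w, `|q z - q w| <= `|e z - e w| + 4].
Proof.
move=> coT cq.
have [N qN] : exists N, forall z, [set: T] z -> `|q z| <= N.
  apply: (@compact_local_global T setT
    (fun A => exists N, forall z, A z -> `|q z| <= N)) => //.
  - by exists 0.
  - by move=> A B AB [N BN]; exists N => z /AB/BN.
  - move=> A B [N AN] [M BM]; exists (Num.max N M) => z.
    by rewrite le_max => -[/AN ->//|/BM ->]; rewrite orbT.
  - move=> z _; exists [set w | `|q w| < `|q z| + 1]; split.
    + by apply: open_sublevel; exact: norm_fun_continuous.
    + by rewrite /= ltrDl.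
    + by exists (`|q z| + 1) => w [/ltW].
have qN' z : - N <= q z <= N by rewrite -ler_norml; exact: qN.
have [|||||G [e [L [[[cG ce L0 e0 bG] [qe _]] Gx ex _]]]] :=
  @end_chart_exists (Num.truncn (4 * N)).+2 q (- N - 1) (N + 1) x setT cq.
- have : 4 * N < (Num.truncn (4 * N)).+1%:R.
    exact: real_truncnS_gt (num_real _).
  by rewrite -[X in _ -> _ <= X / 2 + 2]natr1; lra.
- by have := qN' x; lra.
- exact: openT.
- by move=> z _ /=; have := qN' z; lra.
- by [].
have GT : [set: T] `<=` G.
  apply: (connected_sub_closed coT cG (@closed_closure _ (~` G))).
  - apply/seteqP; split => z // [Gz nGz].
    by have [qz _] := bG z Gz nGz; have := qN' z; lra.
  - by move=> z _; have [|nGz] := pselect (G z); [left|right; exact: subset_closure].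
  - by exists x.
exists e; split => //; first by move=> z; apply: e0; exact: GT.
by move=> z w; apply: qe; exact: GT.
Qed.

End endpoint.

(** * Moving one coordinate *)

Lemma fst_continuous (X Y : topologicalType) : continuous (@fst X Y).
Proof. by move=> z; exact: cvg_fst. Qed.

Lemma snd_continuous (X Y : topologicalType) : continuous (@snd X Y).
Proof. by move=> z; exact: cvg_snd. Qed.

Lemma comp_continuous (X Y Z : topologicalType) (f : X -> Y) (g : Y -> Z) :
  continuous f -> continuous g -> continuous (fun x => g (f x)).
Proof. by move=> cf cg x; apply: continuous_comp; [exact: cf|exact: cg]. Qed.

Lemma pair_continuous (X Y Z : topologicalType) (f : X -> Y) (g : X -> Z) :
  continuous f -> continuous g -> continuous (fun x => (f x, g x)).
Proof. by move=> cf cg x; apply: cvg_pair; [exact: cf|exact: cg]. Qed.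

Lemma continuous_image_compact (X Y : topologicalType) (f : X -> Y) A :
  continuous f -> compact A -> compact (f @` A).
Proof.
by move=> cf cA; apply: continuous_compact => //; exact: continuous_subspaceT.
Qed.

Lemma continuous_image_connected (X Y : topologicalType) (f : X -> Y) A :
  continuous f -> connected A -> connected (f @` A).
Proof.
move=> cf cA; apply: connected_continuous_connected => //.
exact: continuous_subspaceT.
Qed.

Lemma hausdorff_pair (X Y : topologicalType) :
  hausdorff_space X -> hausdorff_space Y -> hausdorff_space (X * Y)%type.
Proof.
rewrite !open_hausdorff => hX hY [x y] [x' y'] xy.
have [xx|xx] := eqVneq x x'.
  have yy : y != y' by apply: contra_neq xy => ->; rewrite xx.
  have [[U V] /= [Uy Vy] [oU oV UV]] := hY _ _ yy.
  exists (snd @^-1` U, snd @^-1` V) => /=; first by rewrite !inE /= in Uy Vy *.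
  have /continuousP cs := @snd_continuous X Y; split; [exact: cs..|].
  by rewrite -preimage_setI (eqP UV) preimage_set0.
have [[U V] /= [Ux Vx] [oU oV UV]] := hX _ _ xx.
exists (fst @^-1` U, fst @^-1` V) => /=; first by rewrite !inE /= in Ux Vx *.
have /continuousP cs := @fst_continuous X Y; split; [exact: cs..|].
by rewrite -preimage_setI (eqP UV) preimage_set0.
Qed.

Lemma connected_chain (S : topologicalType) (M : set S) (C : set (set S))
    (s0 s1 : S) :
  connected M -> (forall U, C U -> open U) -> M `<=` \bigcup_(U in C) U ->
  M s0 -> M s1 ->
  exists n (m : nat -> S), [/\ m 0%N = s0, m n = s1,
    forall i, (i <= n)%N -> M (m i)
    & forall i, (i < n)%N -> exists2 U, C U & U (m i) /\ U (m i.+1)].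
Proof.
move=> coM oC MC Ms0 Ms1.
pose reach s := exists n (m : nat -> S), [/\ m 0%N = s0, m n = s,
    forall i, (i <= n)%N -> M (m i)
    & forall i, (i < n)%N -> exists2 U, C U & U (m i) /\ U (m i.+1)].
have reachM s : reach s -> M s by move=> [n [m [_ <- Mm _]]]; exact: Mm.
have reach_next s t U : reach s -> C U -> U s -> U t -> M t -> reach t.
  move=> [n [m [m0 mn Mm Cm]]] CU Us Ut Mt.
  exists n.+1, (fun i => if (i <= n)%N then m i else t); split.
  - by rewrite leq0n.
  - by rewrite ltnn.
  - by move=> i _; case: ifP => // /Mm.
  - move=> i; rewrite ltnS => lein; have [->|nin] := eqVneq i n.
      by exists U => //=; rewrite leqnn ltnn mn.
    have ltin : (i < n)%N by rewrite ltn_neqAle nin.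
    by have [V CV VV] := Cm i ltin; exists V => //=; rewrite lein ltin.
suff ME : [set s | reach s] = M.
  by have : [set s | reach s] s1; first by rewrite ME.
apply: coM.
- exists s0; exists 0%N, (fun _ => s0); split => //.
- exists (\bigcup_(U in [set U | C U /\ exists2 s, reach s & U s]) U).
    by apply: bigcup_open => U [/oC].
  apply/seteqP; split => s.
    move=> rs; split; first exact: reachM.
    by have [U CU Us] := MC s (reachM s rs); exists U => //; split => //; exists s.
  by move=> [Ms [U [CU [t rt Ut]] Us]]; exact: (reach_next t s U).
- exists (~` \bigcup_(U in [set U | C U /\ exists2 s, M s /\ ~ reach s & U s]) U).
    by rewrite closedC; apply: bigcup_open => U [/oC].
  apply/seteqP; split => s.
    move=> rs; split; first exact: reachM.
    by move=> [U [CU [t [Mt nrt] Ut]] Us]; apply: nrt; exact: (reach_next s t U).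
  move=> [Ms nU]; apply: contrapT => nrs; apply: nU.
  by have [U CU Us] := MC s Ms; exists U => //; split => //; exists s.
Qed.

Lemma floor_step (R : realType) (v w : R) :
  `|v - w| <= 1 -> `|Num.floor v - Num.floor w| <= 1.
Proof.
have := floor_itv v; have := floor_itv w; rewrite !intrD !mulr1z => hw hv.
rewrite ler_norml => vw.
have h1 : (Num.floor v)%:~R < (Num.floor w)%:~R + 2 :> R by lra.
have h2 : (Num.floor w)%:~R < (Num.floor v)%:~R + 2 :> R by lra.
move: h1 h2; rewrite -[2](intrD _ 1 1) -!intrD !ltr_int; lia.
Qed.

Section move.
Context {R : realType} {X : topologicalType}.
Hypotheses (hX : hausdorff_space X) (cX : compact [set: X]).
Hypothesis coX : connected [set: X].
Hypothesis nX : nested_continua X.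

Lemma continuous_attains_max (e : X -> R) (x : X) : continuous e ->
  exists z, forall w, e w <= e z.
Proof.
move=> ce; have [|||z [_ ez]] := @compact_directed_inter X setT X
  (fun w => [set z | e w <= e z]) x cX; last by exists z.
- by move=> w; exact: closed_superlevel.
- move=> i j; have [ij|ij] := leP (e i) (e j).
    by exists j => z /= h; split => //=; exact: le_trans h.
  by exists i => z /= h; split => //=; apply: le_trans h; exact: ltW.
- by move=> j; exists j; split => /=.
Qed.

Lemma continuous_separates (z w : X) : z <> w ->
  exists2 u : X -> R, continuous u & 1 < `|u z - u w|.
Proof.
move=> zw.
have cl1 := accessible_closed_set1 (hausdorff_accessible hX).
have zw0 : [set z] `&` [set w] = set0 by rewrite -subset0 => t [-> /zw].
have /(@uniform_separatorP X R)[u [cu _ uz uw]] :=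
  (@normal_separatorP R X).1 (compact_normal hX cX) _ _ (cl1 z) (cl1 w) zw0.
exists (fun t => 2 * u t); first exact: scale_fun_continuous.
have -> : u z = 0 by apply: uz; exists z.
have -> : u w = 1 by apply: uw; exists w.
by rewrite mulr0 mulr1 sub0r normrN ger0_norm ?ltr1n.
Qed.

Hypothesis dX : directed_functions R X.

(** For each [s] some function separates [f s] from [g s]; directedness and compactness of [K]
    provide one function for all [s]. *)
Lemma directed_separation (S : topologicalType) (f g : S -> X) (K : set S) :
  continuous f -> continuous g -> compact K ->
  (forall s, K s -> f s <> g s) ->
  exists2 q : X -> R, continuous q & forall s, K s -> 1 < `|q (f s) - q (g s)|.
Proof.
move=> cf cg cK fg; apply: contrapT => nq.
pose J := {q : X -> R | continuous q}.
pose F (j : J) := [set s | `|sval j (f s) - sval j (g s)| <= 1].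
have [j|i j|j|s [Ks Fs]] := @compact_directed_inter S K J F
  (exist _ (cst 0) (@cst_continuous _ _ 0)) cK.
- apply: closed_sublevel; apply: norm_fun_continuous.
  apply: add_fun_continuous; last apply: opp_fun_continuous.
    by apply: (comp_continuous cf); exact: (svalP j).
  by apply: (comp_continuous cg); exact: (svalP j).
- have [q cq qij] := dX (svalP i) (svalP j).
  by exists (exist _ q cq) => s /= /qij.
- apply: contrapT => nj; apply: nq; exists (sval j); first exact: (svalP j).
  move=> s Ks; rewrite ltNge; apply/negP => h; apply: nj.
  by exists s.
have [u cu] := continuous_separates (fg _ Ks).
by have := Fs (exist _ u cu); rewrite /F /= leNgt => /negP.
Qed.

(** [C] is the component of [(x', m)] in the compact set [P]; if it missed the graph of [f], so
    would a relatively clopen [F1] around it. The point [(f s, s)] later attaches the moved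
    continuum to the old one. *)
Lemma move_to_graph (S : topologicalType) (M : set S) (f : S -> X)
    (e : X -> R) (x' : X) (m : S) :
  hausdorff_space S -> compact M -> connected M -> continuous f ->
  (forall x, exists2 s, M s & f s = x) -> continuous e -> M m ->
  (forall z, e x' <= e z) -> e (f m) = e x' ->
  exists C : set (X * S), [/\ compact C, connected C, C (x', m),
    forall p, C p -> M p.2 /\ `|e p.1 - e (f p.2)| <= 2
    & exists2 s, M s & C (f s, s)].
Proof.
move=> hS cM coM cf fM ce Mm xmin emx.
pose P := [set p : X * S | M p.2 /\ `|e p.1 - e (f p.2)| <= 2].
have [xm emax] := continuous_attains_max x' ce.
have hXS := hausdorff_pair hX hS.
have cfst := @fst_continuous X S; have csnd := @snd_continuous X S.
have cfsnd : continuous (fun p : X * S => f p.2) := comp_continuous csnd cf.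
have clM : closed M by exact: compact_closed.
have cP : compact P.
  rewrite (_ : P = ([set: X] `*` M) `&`
      [set p | `|e p.1 - e (f p.2)| <= 2]).
    apply: compact_closedI; first exact: compact_setX.
    apply: closed_sublevel; apply: norm_fun_continuous.
    apply: add_fun_continuous; first exact: (comp_continuous cfst ce).
    by apply: opp_fun_continuous; exact: (comp_continuous cfsnd ce).
  by apply/seteqP; split => p /=; [move=> []|move=> [[]]].
have Pxm : P (x', m) by split => //=; rewrite emx subrr normr0.
suff [s Ms Cs] : exists2 s, M s & connected_component P (x', m) (f s, s).
  have [_ [cC coC]] := component_continuum hXS cP Pxm.
  exists (connected_component P (x', m)); split => //.
  - exact: connected_component_refl.
  - by move=> p /connected_component_sub.
  - by exists s.
apply: contrapT => nograph.
pose graph := (fun s => (f s, s)) @` M.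
have cgraph : compact graph.
  apply: continuous_image_compact => //.
  by apply: pair_continuous => // s; exact: cvg_id.
have [F1 [cF1 cF2 F1c F1P F1g]] : exists G, [/\ closed G, closed (P `\` G),
    connected_component P (x', m) `<=` G, G `<=` P & G `<=` ~` graph].
  apply: component_clopen => //.
    by rewrite openC; exact: compact_closed.
  by move=> p Cp [s Ms sp]; apply: nograph; exists s => //; rewrite sp.
set F2 := P `\` F1 in cF2.
have F1xm : F1 (x', m) by apply: F1c; exact: connected_component_refl.
have F12 p : P p -> F1 p \/ F2 p.
  by move=> Pp; have [|nF1] := pselect (F1 p); [left|right].
have cpF1 : compact F1 by exact: (subclosed_compact cF1 cP).
have cpF2 : compact F2 by apply: (subclosed_compact cF2 cP) => p [].
have [q cq qF1] : exists2 q : X -> R, continuous q &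
    forall p, F1 p -> 1 < `|q p.1 - q (f p.2)|.
  apply: directed_separation => // -[b s] F1bs /= bfs.
  by apply: (F1g (b, s)) => //; exists s; [have [] := F1P _ F1bs|rewrite bfs].
pose small : set (set S) := [set U | open U /\
  forall s t, U s -> U t -> M s -> M t ->
  [/\ `|e (f s) - e (f t)| <= 2^-1, `|q (f s) - q (f t)| <= 2^-1
    & forall b, F1 (b, s) -> F2 (b, t) -> False]].
have smallM : M `<=` \bigcup_(U in small) U.
  move=> s Ms.
  have cpair : continuous (fun b : X => (b, s)).
    by apply: pair_continuous => [b|]; [exact: cvg_id|exact: cst_continuous].
  have cslice (F : set (X * S)) : closed F -> compact [set b | F (b, s)].
    move=> cF; have h := (continuous_closedP _).1 cpair _ cF.
    exact: (subclosed_compact h cX).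
  have [W1 [W2 [oW1 oW2 FW1 FW2 W12]]] : exists U V, [/\ open U, open V,
      [set b | F1 (b, s)] `<=` U, [set b | F2 (b, s)] `<=` V & U `&` V = set0].
    apply: compact_separation => //; [exact: cslice|exact: cslice|].
    by rewrite -subset0 => b [/= ? []].
  (* The points of [S] over which the slice of [F] lies in [W]; they form an open set, since the
     projection of a compact set is closed. *)
  pose V (F : set (X * S)) (W : set X) :=
    ~` (snd @` (F `&` [set p | ~ W p.1])).
  have oV F W : compact F -> open W -> open (V F W).
    move=> cF oW; rewrite openC; apply: compact_closed => //.
    apply: continuous_image_compact => //; apply: compact_closedI => //.
    have /continuous_closedP cfst' := cfst.
    by apply: (cfst' (~` W)); rewrite closedC.
  have VP F W b t : V F W t -> F (b, t) -> W b.
    by move=> Vt Fbt; apply: contrapT => nW; apply: Vt; exists (b, t).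
  have Vs F W : (forall b, F (b, s) -> W b) -> V F W s.
    by move=> FW [[b t] [Fbt /= nW] /= ts]; apply: nW; apply: FW; rewrite -ts.
  pose near_s (u : X -> R) := [set t | `|u (f t) - u (f s)| < 4^-1].
  have onear u : continuous u -> open (near_s u).
    move=> cu; apply: open_sublevel; apply: norm_fun_continuous.
    apply: add_fun_continuous; first exact: (comp_continuous cf cu).
    exact: cst_continuous.
  have nears u : near_s u s by rewrite /near_s /= subrr normr0 invr_gt0 ltr0n.
  have nearst u t t' : near_s u t -> near_s u t' ->
      `|u (f t) - u (f t')| <= 2^-1.
    rewrite /near_s /= => h h'; rewrite -(subrKA (u (f s))).
    apply: le_trans (ler_normD _ _) _; rewrite [X in _ + X]distrC; lra.
  exists (near_s e `&` near_s q `&` (V F1 W1 `&` V F2 W2)).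
    split; first by do !apply: openI; [exact: onear|exact: onear|exact: oV|exact: oV].
    move=> t t' [[et qt] [V1t V2t]] [[et' qt'] [V1t' V2t']] Mt Mt'; split.
    - exact: nearst.
    - exact: nearst.
    - move=> b /(VP _ _ _ _ V1t) W1b /(VP _ _ _ _ V2t') W2b.
      by have : (W1 `&` W2) b by []; rewrite W12.
  by split; split; [exact: nears|exact: nears|exact: Vs|exact: Vs].
(* The chain ends over a maximum of [e], so that the walk [g] of floors is ascending and spans the
   whole range of [e]. *)
have [s1 Ms1 fs1] := fM xm.
have [n [ch [ch0 chn chM chC]]] :=
  connected_chain coM (fun U (h : small U) => h.1) smallM Mm Ms1.
have chsmall i : (i < n)%N -> [/\ `|e (f (ch i)) - e (f (ch i.+1))| <= 2^-1,
    `|q (f (ch i)) - q (f (ch i.+1))| <= 2^-1,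
    forall b, F1 (b, ch i) -> F2 (b, ch i.+1) -> False
    & forall b, F1 (b, ch i.+1) -> F2 (b, ch i) -> False].
  move=> lin; have [U [_ sU] [Ui Ui1]] := chC i lin.
  have [ei qi Fi] := sU _ _ Ui Ui1 (chM _ (ltnW lin)) (chM _ lin).
  by have [_ _ Fi'] := sU _ _ Ui1 Ui (chM _ lin) (chM _ (ltnW lin)).
(* The lift [D] of the walk [ch] colours [X] by [F1] or [F2] through
   [b |-> (b, ch i)]; connectedness forces the colour of [x'], but where
   [q b - q (f (ch i))] changes sign [(b, ch i)] is too close to the graph. *)
pose lo := e x'; pose v i := e (f (ch i)) - lo; pose g i := Num.floor (v i).
have v0 : v 0%N = 0 by rewrite /v ch0 emx subrr.
have vn : v n = e xm - lo by rewrite /v chn fs1.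
have vge0 i : 0 <= v i by rewrite subr_ge0.
have asc : ascending_walk g 0 n.
  split => // [i ilt|i ilt].
    apply: floor_step; rewrite distrC /v opprB addrA subrK.
    have [h _ _ _] := chsmall i ilt; lra.
  rewrite /g !le_floor ?v0 // vn /v; apply: lerB => //; exact: emax.
have celo : continuous (fun z => e z - lo).
  by apply: add_fun_continuous => //; exact: cst_continuous.
have g0 : (g 0%N)%:~R = 0 :> R by rewrite /g v0 floor0.
have [||||D [[cD De Dc Da] [Dl _]]] := ascending_walk_liftable hX cX nX asc
  (tau := 4^-1) (Y := [set: X]) _ _ _ celo.
- by rewrite invr_ge0.
- by lra.
- exact: closedT.
- move=> z _; rewrite g0 subr_ge0 xmin /= /g vn.
  have := floorD1_gt (e xm - lo); rewrite intrD mulr1z.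
  have := emax z; lra.
have DP i b : D i b -> P (b, ch i).
  move=> /De[/andP[_ lin] _ eb]; split => /=; first exact: chM.
  have := floor_itv (v i); rewrite -/(g i) intrD mulr1z /v ler_norml.
  lra.
have fin_closed (B : nat -> set X) : (forall i, closed (B i)) ->
    closed (\bigcup_(i in `I_n.+1) B i).
  by move=> cB; apply: closed_bigcup => // i _.
have Dn i b : D i b -> (i < n.+1)%N by move=> /De[/andP[_]].
have cslice (F : set (X * S)) i : closed F -> closed [set b | F (b, ch i)].
  apply: (continuous_closedP _).1.
  by apply: pair_continuous => [b|]; [exact: cvg_id|exact: cst_continuous].
pose C (F : set (X * S)) :=
  \bigcup_(i in `I_n.+1) (D i `&` [set b | F (b, ch i)]).
have cC F : closed F -> closed (C F).
  by move=> cF; apply: fin_closed => i; apply: closedI => //; exact: cslice.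
have C12 : C F1 `&` C F2 = set0.
  rewrite -subset0 => b [[i _ [Di F1i]] [j _ [Dj F2j]]].
  have := Da _ _ _ Di Dj; have := Da _ _ _ Dj Di; have := Dn _ _ Di.
  have := Dn _ _ Dj => jn in_ ji ij.
  have [ijE|ijE] := eqVneq i j; first by case: F2j => _; rewrite -ijE.
  have [iE|jE] : i = j.+1 \/ j = i.+1 by lia.
    by have [_ _ _ h] := chsmall j ltac:(lia); apply: (h b); rewrite // -iE.
  by have [_ _ h _] := chsmall i ltac:(lia); apply: (h b); rewrite // -jE.
have CT : [set: X] `<=` C F1.
  apply: (connected_sub_closed coX (cC _ cF1) (cC _ cF2) C12).
    move=> b _; have [//|i Di] := Dc b.
    by have [h|h] := F12 _ (DP _ _ Di); [left|right]; exists i => //;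
      exact: Dn Di.
  exists x'; split => //; have [//|i Di] := Dc x'.
  (* [x'] is a minimum of [e], so the lower end clause puts it at time 0, over [m]. *)
  have i0 : i = 0%N by apply: Dl Di _; rewrite g0 /lo subrr; lra.
  by exists i; [exact: Dn Di|split => //=; rewrite i0 ch0].
pose Sp := \bigcup_(i in `I_n.+1) (D i `&` [set b | q (f (ch i)) <= q b]).
pose Sm := \bigcup_(i in `I_n.+1) (D i `&` [set b | q b <= q (f (ch i))]).
have cSp : closed Sp.
  by apply: fin_closed => i; apply: closedI => //; exact: closed_superlevel.
have cSm : closed Sm.
  by apply: fin_closed => i; apply: closedI => //; exact: closed_sublevel.
(* [Sp] and [Sm] are closed, cover [X] and contain a maximum and a minimum of [q], so they meet in
   some [b]. Its two times differ by at most 1, which puts [q b] within 1/2 of [q (f (ch i))],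
   closer than [F1] allows. *)
have [b [[i _ [Di qi]] [j _ [Dj qj]]]] : Sp `&` Sm !=set0.
  apply: contrapT => h; have {}h : Sp `&` Sm = set0 by apply/nonemptyPn.
  have SpT : [set: X] `<=` Sp.
    apply: (connected_sub_closed coX cSp cSm h).
      move=> b _; have [//|i Di] := Dc b.
      by have [h'|h'] := leP (q (f (ch i))) (q b); [left|right]; exists i => //;
        [exact: Dn Di|exact: Dn Di|split => //=; exact: ltW].
    have [z zmax] := continuous_attains_max x' cq; have [//|i Di] := Dc z.
    by exists z; split => //; exists i; [exact: Dn Di|split => //=].
  have [z zmin] := continuous_attains_max x' (opp_fun_continuous cq).
  have [//|i Di] := Dc z.
  suff : (Sp `&` Sm) z by rewrite h.
  split; first exact: SpT.
  by exists i; [exact: Dn Di|split => //=; rewrite -lerN2].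
have qij : `|q (f (ch i)) - q (f (ch j))| <= 2^-1.
  have := Da _ _ _ Di Dj; have := Da _ _ _ Dj Di.
  have := Dn _ _ Di; have := Dn _ _ Dj => jn in_ ji ij.
  have [->|ijE] := eqVneq i j; first by rewrite subrr normr0 invr_ge0.
  have [iE|jE] : i = j.+1 \/ j = i.+1 by lia.
    by have [_ h _ _] := chsmall j ltac:(lia); rewrite iE distrC.
  by have [_ h _ _] := chsmall i ltac:(lia); rewrite jE.
have nF1 : ~ F1 (b, ch i).
  move=> /qF1 /=; rewrite ltNge => /negP; apply.
  by move: qij qi qj => /=; rewrite !ler_norml; lra.
have : (C F1 `&` C F2) b.
  split; first exact: CT.
  exists i; first exact: Dn Di.
  by split => //; split => //; exact: DP.
by rewrite C12.
Qed.

End move.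

(** * Powers *)

Section coordinates.
Context {K : eqType}.

Lemma prod_continuous (Z : topologicalType) (T : K -> topologicalType)
    (f : Z -> prod_topology T) :
  (forall k, continuous (fun z => f z k)) -> continuous f.
Proof.
move=> cf z; apply/cvg_sup => k U [V [[W oW <-] Wfz] WU].
apply: (filterS WU); apply: (cf k z W).
by apply: open_nbhs_nbhs.
Qed.

Lemma coord_continuous (T : K -> topologicalType) k :
  continuous (fun s : prod_topology T => s k).
Proof. exact: (@proj_continuous K T k). Qed.

Context {X : topologicalType}.
Local Notation S := (prod_topology (fun _ : K => X)).

Definition upd k (p : X * S) : S := fun j => if j == k then p.1 else p.2 j.

Definition overwrite (ks : seq K) (y s : S) : S :=
  fun j => if j \in ks then y j else s j.

Lemma upd_continuous k : continuous (upd k).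
Proof.
apply: prod_continuous => j; rewrite /upd.
case: (j == k); first exact: fst_continuous.
exact: (comp_continuous (@snd_continuous _ _) (@coord_continuous _ j)).
Qed.

Lemma overwrite_continuous ks y : continuous (overwrite ks y).
Proof.
apply: prod_continuous => j; rewrite /overwrite.
case: (j \in ks); first exact: cst_continuous.
exact: coord_continuous.
Qed.

Lemma upd_id k s : upd k (s k, s) = s.
Proof. by apply/funext => j; rewrite /upd /=; case: eqP => [->|]. Qed.

Lemma overwrite_cons k ks y s :
  overwrite (k :: ks) y s = upd k (y k, overwrite ks y s).
Proof.
by apply/funext => j; rewrite /overwrite /upd inE /=; case: eqP => [->|].
Qed.

End coordinates.

Section fupcon.
Context {R : realType} {X : topologicalType} {K : eqType}.
Hypotheses (hX : hausdorff_space X) (cX : compact [set: X]).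
Hypothesis coX : connected [set: X].
Hypothesis nX : nested_continua X.
Hypothesis dX : directed_functions R X.
Local Notation S := (prod_topology (fun _ : K => X)).

Lemma power_hausdorff : hausdorff_space S.
Proof. exact: (@hausdorff_product K (fun _ => X)). Qed.

Lemma power_compact : compact [set: S].
Proof.
have := @tychonoff K (fun _ => X) (fun _ => setT) (fun _ => cX).
by congr (compact _); apply/seteqP; split.
Qed.

(** The closeness relations given by finitely many coordinates and a function are directed, and only
    equal points satisfy all of them. By compactness one of them relates no point of [N] to a point
    outside [U]. *)
Lemma power_tube (N U : set S) : compact N -> open U -> N `<=` U ->
  exists (ks : seq K) (q : X -> R), continuous q /\
    forall m y, N m -> (forall k, k \in ks -> `|q (m k) - q (y k)| <= 1) -> U y.
Proof.
move=> cN oU NU; apply: contrapT => nq.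
pose J := (seq K * {q : X -> R | continuous q})%type.
pose F (j : J) := [set p : S * S | forall k, k \in j.1 ->
  `|sval j.2 (p.1 k) - sval j.2 (p.2 k)| <= 1].
have cNU : compact (N `*` ~` U).
  apply: compact_setX => //; apply: (subclosed_compact _ power_compact) => //.
  by rewrite closedC.
have [j|i j|j|p [[Np nUp] Fp]] := @compact_directed_inter _ _ J F
  ([::], exist _ (cst 0) (@cst_continuous _ _ 0)) cNU.
- rewrite (_ : F j = \bigcap_(k in [set` j.1])
      [set p : S * S | `|sval j.2 (p.1 k) - sval j.2 (p.2 k)| <= 1]); last first.
    by apply/seteqP; split => p.
  apply: closed_bigI => k _; apply: closed_sublevel; apply: norm_fun_continuous.
  have cc (g : S * S -> S) : continuous g ->
      continuous (fun p : S * S => sval j.2 (g p k)).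
    move=> cg; apply: (comp_continuous _ (svalP j.2)).
    exact: (comp_continuous cg (@coord_continuous _ _ k)).
  apply: add_fun_continuous; first by apply: cc; exact: fst_continuous.
  by apply: opp_fun_continuous; apply: cc; exact: snd_continuous.
- have [q cq qij] := dX (svalP i.2) (svalP j.2).
  exists (i.1 ++ j.1, exist _ q cq) => p Fp; split => k kk.
    by have /qij[] := Fp k ltac:(by rewrite mem_cat kk).
  by have /qij[] := Fp k ltac:(by rewrite mem_cat kk orbT).
- apply: contrapT => nj; apply: nq; exists j.1, (sval j.2); split.
    exact: (svalP j.2).
  move=> m y Nm my; apply: contrapT => nUy; apply: nj; by exists (m, y).
apply: nUp; suff -> : p.2 = p.1 by exact: NU.
apply/funext => k; apply: contrapT => pk.
have [u cu] := continuous_separates (R := R) hX cX pk.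
have := Fp ([:: k], exist _ u cu) k; rewrite inE eqxx => /(_ isT) /=.
by rewrite distrC leNgt => /negP.
Qed.

(** Changing one coordinate stays within a connected image of [X], so the component of [s0] contains
    all points obtained by finitely many changes; by [power_tube] these are dense. *)
Lemma power_connected : connected [set: S].
Proof.
have [s0|nS] := pselect (exists s : S, True); last first.
  rewrite (_ : setT = set0); first exact: connected0.
  by rewrite -subset0 => s _; apply: nS; exists s.
case: s0 => s0 _.
pose C := connected_component [set: S] s0.
have cC : closed C by apply: component_closed; exact: closedT.
suff <- : C = setT by exact: component_connected.
apply/seteqP; split => // y _; apply: contrapT => nCy.
have [ks [q [_ kq]]] : exists (ks : seq K) (q : X -> R), continuous q /\
    forall m w, [set y] m ->
      (forall k, k \in ks -> `|q (m k) - q (w k)| <= 1) -> (~` C) w.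
  apply: power_tube; [exact: compact_set1|by rewrite openC|by move=> _ ->].
apply: (kq y (overwrite ks y s0)) => //.
  by move=> k kk; rewrite /overwrite kk subrr normr0.
elim: ks {kq} => [|k ks IH]; first exact: connected_component_refl.
apply: connected_component_trans IH _.
exists ((fun b => upd k (b, overwrite ks y s0)) @` setT).
  split => //; first by exists (overwrite ks y s0 k) => //; exact: upd_id.
  apply: continuous_image_connected => //.
  apply: (comp_continuous _ (@upd_continuous _ _ k)); apply: pair_continuous.
    by move=> b; exact: cvg_id.
  exact: cst_continuous.
by exists (y k); rewrite // overwrite_cons.
Qed.

(** [N'] is the union of [N] and the image under [upd k] of the set [C] from [move_to_graph]; the
    graph point in [C] is sent back into [N], which keeps the union connected. *)
Lemma power_move (N : set S) (k : K) (q : X -> R) (e : X -> R) z y :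
  compact N -> connected N -> (forall b, exists2 s, N s & s k = b) ->
  continuous e -> (forall b, 0 <= e b) ->
  (forall b c, `|7 * q b - 7 * q c| <= `|e b - e c| + 4) ->
  N z -> e (z k) = 0 -> e y < 1 ->
  exists N', [/\ compact N', connected N', N `<=` N', N' (upd k (y, z))
    & forall w, N' w -> exists2 s, N s &
        (forall j, j != k -> w j = s j) /\ `|q (s k) - q (w k)| <= 1].
Proof.
move=> cN coN Nk ce e0 qe Nz ez ey.
(* Raising [e] to at least 1 makes both [z k] and [y] minima, as [move_to_graph] requires, at the
   cost of an error of 1. *)
pose e1 b := Num.max (e b) 1.
have ce1 : continuous e1.
  by apply: max_fun_continuous => //; exact: cst_continuous.
have e1E b : [/\ 1 <= e1 b, e b <= e1 b & e1 b <= e b + 1].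
  by rewrite /e1; have := e0 b; have [h|h] := leP (e b) 1; split; lra.
have e1z : e1 (z k) = 1 by rewrite /e1 ez; apply/max_idPr.
have e1y : e1 y = 1 by rewrite /e1; apply/max_idPr; exact: ltW.
(* Values of [e1] within 2 give values of [e] within 3, and 3 + 4 = 7 is the factor in front of
   [q]. *)
have qe1 b c : `|e1 b - e1 c| <= 2 -> `|q c - q b| <= 1.
  have := qe b c; have [_ hb hb'] := e1E b; have [_ hc hc'] := e1E c.
  have h : `|e b - e c| <= `|e1 b - e1 c| + 1.
    have h1 := ler_norm (e1 b - e1 c); have h2 := ler_norm (e1 c - e1 b).
    by rewrite distrC in h2; rewrite ler_norml; lra.
  rewrite distrC -mulrBr normrM (_ : `|7| = 7 :> R); last by rewrite ger0_norm.
  by move: h; set a := `|e b - e c|; set d := `|e1 b - e1 c|; set r := `|q _ - _|;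
    lra.
have [C [cC coC Cyz CP [s Ns Cs]]] := move_to_graph hX cX coX nX dX
  power_hausdorff cN coN (@coord_continuous _ _ k) Nk ce1 Nz
  (x' := y) (fun b => ltac:(by rewrite e1y; case: (e1E b)))
  ltac:(by rewrite e1z e1y).
exists (N `|` upd k @` C); split.
- apply: compactU => //; apply: continuous_image_compact => //.
  exact: upd_continuous.
- apply: connectedU => //.
    by exists s; split => //; exists (s k, s) => //; exact: upd_id.
  by apply: continuous_image_connected => //; exact: upd_continuous.
- by move=> w; left.
- by right; exists (y, z).
- move=> w [Nw|[[b t] Cbt <-]].
    by exists w => //; split => //; rewrite subrr normr0.
  have [/= Nt et] := CP _ Cbt; exists t => //; split.
    by move=> j /negbTE jk; rewrite /upd jk.
  by rewrite /upd eqxx /=; exact: qe1.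
Qed.

Theorem power_fupcon (M U : set S) : continuum M ->
  (forall k b, exists2 s, M s & s k = b) -> open U -> M `<=` U ->
  exists V, [/\ open V, connected V, M `<=` V & V `<=` U].
Proof.
move=> [[s0 Ms0] [cM coM]] Mk oU MU.
pose thick := [set N : set S | [/\ compact N, connected N, M `<=` N & N `<=` U]].
exists (\bigcup_(N in thick) N).
suff oV : open (\bigcup_(N in thick) N).
  split => //.
  - apply: bigcup_connected; last by move=> N [].
    by exists s0 => N [_ _ MN _]; exact: MN.
  - by move=> s Ms; exists M => //; split.
  - by move=> s [N [_ _ _ NU]] /NU.
rewrite openE => z [N [cN coN MN NU] Nz].
have [ks [q [cq kq]]] := power_tube cN oU NU.
have c7q : continuous (fun b => 7 * q b) by exact: scale_fun_continuous.
have /choice[e eP] : forall k, exists e : X -> R,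
    [/\ continuous e, forall b, 0 <= e b, e (z k) = 0
    & forall b c, `|7 * q b - 7 * q c| <= `|e b - e c| + 4].
  by move=> k; exact: (endpoint_chart hX cX nX (z k) coX c7q).
pose B (ks : seq K) := [set y : S | forall k, k \in ks -> e k (y k) < 1].
have oB l : open (B l).
  elim: l => [|k l IH].
    by rewrite (_ : B [::] = setT); [exact: openT|apply/seteqP; split].
  rewrite (_ : B (k :: l) = [set y : S | e k (y k) < 1] `&` B l).
    apply: openI => //; apply: open_sublevel.
    have [ce _ _ _] := eP k.
    exact: (comp_continuous (@coord_continuous _ _ k) ce).
  apply/seteqP; split => y.
    by move=> By; split => [|j jl]; apply: By; rewrite inE ?eqxx ?jl ?orbT.
  by move=> [ey By] j; rewrite inE => /orP[/eqP ->|/By].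
suff BV : B ks `<=` \bigcup_(N in thick) N.
  apply: (filterS BV); apply: open_nbhs_nbhs; split => // k _.
  by have [_ _ -> _] := eP k.
move=> y By.
have qzy k : k \in ks -> `|q (z k) - q (y k)| <= 1.
  move=> /By ey; have [_ e0 ez qe] := eP k; have := qe (z k) (y k).
  rewrite ez sub0r normrN (ger0_norm (e0 _)) -mulrBr normrM.
  by rewrite (_ : `|7| = 7 :> R); [lra|rewrite ger0_norm].
(* Points of the growing continuum are always compared with points of the original [N], and
   coordinates still to be moved agree exactly, so the errors do not add up. *)
have moves l : {subset l <= ks} -> exists N', [/\ compact N', connected N',
    N `<=` N', N' (overwrite l y z) & forall w, N' w -> exists2 m, N m &
    (forall k, k \in l -> `|q (m k) - q (w k)| <= 1) /\
    (forall k, k \notin l -> w k = m k)].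
  elim: l => [_|k l IH kl].
    exists N; split => //.
    by move=> w Nw; exists w.
  have [|N1 [cN1 coN1 NN1 N1o N1N]] := IH.
    by move=> j jl; apply: kl; rewrite inE jl orbT.
  have [kinl|kl'] := boolP (k \in l).
    have mE j : (j \in k :: l) = (j \in l).
      by rewrite inE; case: eqP => [->|].
    exists N1; split => //.
      rewrite (_ : overwrite (k :: l) y z = overwrite l y z) //.
      by apply/funext => j; rewrite /overwrite mE.
    move=> w /N1N[m Nm [m1 m2]]; exists m => //.
    by split => j; rewrite mE; [exact: m1|exact: m2].
  have [ce e0 ez qe] := eP k.
  have N1k b : exists2 s, N1 s & s k = b.
    by have [s Ms sb] := Mk k b; exists s => //; apply/NN1/MN.
  have eo : e k (overwrite l y z k) = 0 by rewrite /overwrite (negbTE kl').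
  have ey := By k (kl k (mem_head k l)).
  have [N2 [cN2 coN2 N12 N2o N2N]] :=
    power_move cN1 coN1 N1k ce e0 qe N1o eo ey.
  exists N2; split => //; first by move=> w /NN1/N12.
    by rewrite overwrite_cons.
  move=> w /N2N[s /N1N[m Nm [ms1 ms2]] [ws qsw]]; exists m => //.
  split => j; rewrite inE; have [->|jk] /= := eqVneq j k => //.
    by rewrite -ms2.
  - by rewrite (ws j jk); exact: ms1.
  - by rewrite (ws j jk); exact: ms2.
have [N' [cN' coN' NN' N'o N'N]] := moves ks (fun k h => h).
(* All other coordinates move at once: the points agreeing with [y] on [ks] form a connected set
   that meets [N'], and it lies in [U] because [y] is close to [z] on [ks]. *)
exists (N' `|` overwrite ks y @` setT).
  split.
  - apply: compactU => //; apply: continuous_image_compact power_compact.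
    exact: overwrite_continuous.
  - apply: connectedU => //.
      by exists (overwrite ks y z); split => //; exists z.
    apply: continuous_image_connected power_connected.
    exact: overwrite_continuous.
  - by move=> w /MN/NN'; left.
  - move=> w [/N'N[m Nm [mw _]]|[s _ <-]]; first exact: kq mw.
    by apply: (kq z) => // k kk; rewrite /overwrite kk; exact: qzy.
right; exists y => //; apply/funext => k; rewrite /overwrite.
by case: ifP.
Qed.

End fupcon.

(** * Chainable hereditarily indecomposable spaces *)

Lemma hereditarily_indecomposable_nested (T : topologicalType) :
  hereditarily_indecomposable [set: T] -> nested_continua T.
Proof.
move=> [_ hi] A B [[a Aa] [cA coA]] [[b Bb] [cB coB]] AB.
apply: contrapT => /not_orP[nAB nBA].
have cAB : continuum (A `|` B).
  by split; [exists a; left|split; [exact: compactU|exact: connectedU]].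
have [_] := hi _ (subsetT _) cAB; apply; exists A, B.
split; first by split; [exists a|].
split; first by split; [exists b|].
split; last split => //; split; try by [move=> z; left|move=> z; right].
- by move=> ABA; apply: nBA => z Bz; apply: ABA; right.
- by move=> ABB; apply: nAB => z Az; apply: ABB; left.
Qed.

Section chain_coordinate.
Context {R : realType} {T : topologicalType}.
Hypotheses (hT : hausdorff_space T) (cT : compact [set: T]).
Variables (n : nat) (C : nat -> set T).
Hypotheses (oC : forall i, (i < n)%N -> open (C i))
  (covC : forall z, exists2 i, (i < n)%N & C i z)
  (adjC : forall i j z, (i < n)%N -> (j < n)%N -> C i z -> C j z ->
     (i <= j.+1)%N).

(** [w i] is a Urysohn function that vanishes off the links after [i] and is 1 off the links up to
    [i]. In the sum of the [w i], only the terms [j - 1] and [j] are undetermined on [C j]: earlier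
    ones are 1, later ones 0. *)
Lemma chain_coordinate : exists2 q : T -> R, continuous q &
  forall j z, (j < n)%N -> C j z -> (j.-1)%:R <= q z <= (j.+1)%:R.
Proof.
pose A i := \bigcup_(j in [set j | (j < n)%N /\ (j <= i)%N]) C j.
pose B i := \bigcup_(j in [set j | (j < n)%N /\ (i < j)%N]) C j.
have oA i : open (A i) by apply: bigcup_open => j [/oC].
have oB i : open (B i) by apply: bigcup_open => j [/oC].
have /choice[w wP] : forall i, exists u : T -> R, [/\ continuous u,
    forall z, 0 <= u z <= 1, forall z, ~ B i z -> u z = 0
    & forall z, ~ A i z -> u z = 1].
  move=> i; have BA0 : ~` B i `&` ~` A i = set0.
    rewrite -subset0 => z [nBz nAz]; have [j jn Cj] := covC z.
    have [ji|ij] := leqP j i; first by apply: nAz; exists j.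
    by apply: nBz; exists j.
  have cB : closed (~` B i) by rewrite closedC.
  have cA : closed (~` A i) by rewrite closedC.
  have /(@uniform_separatorP T R)[u [cu u01 uB uA]] :=
    (@normal_separatorP R T).1 (compact_normal hT cT) _ _ cB cA BA0.
  exists u; split => //.
  - by move=> z; have /= := u01 (u z) (ex_intro2 _ _ z I erefl); rewrite in_itv.
  - by move=> z nBz; apply: uB; exists z.
  - by move=> z nAz; apply: uA; exists z.
pose Q m z := \sum_(i < m) w i z.
have cQ m : continuous (Q m).
  elim: m => [|m IH].
    rewrite (_ : Q 0%N = cst 0); first exact: cst_continuous.
    by apply/funext => z; rewrite /Q big_ord0.
  rewrite (_ : Q m.+1 = fun z => Q m z + w m z); last first.
    by apply/funext => z; rewrite /Q big_ord_recr.
  by apply: add_fun_continuous => //; have [] := wP m.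
exists (Q n); first exact: cQ.
move=> j z jn Cjz.
suff h m : (m <= n)%N -> (minn m j.-1)%:R <= Q m z <= (minn m j.+1)%:R.
  have := h n (leqnn n).
  by rewrite (minn_idPr _) ?(leq_trans (leq_pred j) (ltnW jn)) // (minn_idPr _).
elim: m => [_|m IH mn]; first by rewrite /Q big_ord0 !min0n lexx.
have {IH} := IH (ltnW mn); rewrite [Q m.+1 z]big_ord_recr /= -/(Q m z).
have [_ w01 wB wA] := wP m; have := w01 z.
have w0 : (j < m)%N -> w m z = 0.
  move=> jm; apply: wB => -[k [kn mk] Ckz].
  by have := adjC kn jn Ckz Cjz; lia.
have w1 : (m.+1 < j)%N -> w m z = 1.
  move=> jm; apply: wA => -[k [kn km] Ckz].
  by have := adjC jn kn Cjz Ckz; lia.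
have lo : (minn m.+1 j.-1)%:R = (minn m j.-1)%:R + (m.+1 < j)%:R :> R.
  by rewrite -natrD; congr _%:R; case: ltnP; lia.
have hi : (minn m.+1 j.+1)%:R = (minn m j.+1)%:R + (m <= j)%:R :> R.
  by rewrite -natrD; congr _%:R; case: (leqP m j); lia.
rewrite lo hi => h01 h.
have h0 : (m.+1 < j)%:R <= w m z.
  by case: (ltnP m.+1 j) => [/w1 ->|_] //; have /andP[] := h01.
have h1 : w m z <= (m <= j)%:R.
  by case: (leqP m j) => [_|/w0 ->] //; have /andP[] := h01.
lra.
Qed.

End chain_coordinate.

(** On each link [u1] and [u2] oscillate by at most 1/4. If [q] differs by at most 1, the link
    indices differ by at most 3, so at most 4 links are crossed and the total change is at most
    1. *)
Lemma chainable_directed (R : realType) (T : topologicalType) :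
  hausdorff_space T -> compact [set: T] -> chainable [set: T] ->
  directed_functions R T.
Proof.
move=> hT cT chT u1 u2 cu1 cu2.
pose small : set (set T) := [set O | open O /\ forall z w, O z -> O w ->
  `|u1 z - u1 w| <= 4^-1 /\ `|u2 z - u2 w| <= 4^-1].
have smallT : [set: T] `<=` \bigcup_(O in small) O.
  move=> s _; pose near_s (u : T -> R) := [set t | `|u t - u s| < 8^-1].
  have onear u : continuous u -> open (near_s u).
    move=> cu; apply: open_sublevel; apply: norm_fun_continuous.
    by apply: add_fun_continuous => //; exact: cst_continuous.
  have nears u : near_s u s by rewrite /near_s /= subrr normr0 invr_gt0 ltr0n.
  have nearst u t t' : near_s u t -> near_s u t' -> `|u t - u t'| <= 4^-1.
    rewrite /near_s /= => h h'; rewrite -(subrKA (u s)).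
    apply: le_trans (ler_normD _ _) _; rewrite [X in _ + X]distrC; lra.
  exists (near_s u1 `&` near_s u2); last by split; exact: nears.
  split; first by apply: openI; exact: onear.
  by move=> t t' [? ?] [? ?]; split; exact: nearst.
have [n [C [CO [Ccov Cadj]]]] := chT small (fun O h => h.1) smallT.
have oC i : (i < n)%N -> open (C i).
  by move=> /CO[[W [oW ->]] _]; rewrite setIT.
have Csmall i z w : (i < n)%N -> C i z -> C i w ->
    `|u1 z - u1 w| <= 4^-1 /\ `|u2 z - u2 w| <= 4^-1.
  by move=> /CO[_ [W [[_ Ws] CW]]] /CW Wz /CW Ww; exact: Ws.
have covC z : exists2 i, (i < n)%N & C i z.
  by have [//|i] := Ccov z; exists i.
have adjC i j z : (i < n)%N -> (j < n)%N -> C i z -> C j z -> (i <= j.+1)%N.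
  by move=> ni nj Ci Cj; have [+ _] := Cadj i j ni nj; case=> //; exists z.
have [q cq qC] := chain_coordinate (R := R) hT cT oC covC adjC.
exists q => // z w.
have far d i x y : (i + d < n)%N -> C i x -> C (i + d)%N y ->
    `|u1 x - u1 y| <= d.+1%:R / 4 /\ `|u2 x - u2 y| <= d.+1%:R / 4.
  elim: d y => [|d IH] y.
    by rewrite addn0 mul1r => lin Cx Cy; exact: Csmall lin Cx Cy.
  move=> idn Cx Cy; have idn' : (i + d < n)%N by lia.
  have [_ [|t [Ct Ct']]] := Cadj (i + d)%N (i + d.+1)%N idn' idn; first by lia.
  have [h1 h2] := IH t idn' Cx Ct; have [h1' h2'] := Csmall _ _ _ idn Ct' Cy.
  rewrite -natr1 mulrDl mul1r; split.
    by apply: le_trans (ler_distD (u1 t) _ _) _; exact: lerD.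
  by apply: le_trans (ler_distD (u2 t) _ _) _; exact: lerD.
wlog [i [j [ni nj Ci Cj ij]]] : z w / exists i j,
    [/\ (i < n)%N, (j < n)%N, C i z, C j w & (i <= j)%N].
  move=> H; have [i ni Ci] := covC z; have [j nj Cj] := covC w.
  have [ij|ji] := leqP i j; first by apply: H; exists i, j.
  rewrite distrC [`|u1 _ - _|]distrC [`|u2 _ - _|]distrC.
  by apply: H; exists j, i; split => //; exact: ltnW.
move=> qzw; have /andP[_ qz] := qC _ _ ni Ci; have /andP[qw _] := qC _ _ nj Cj.
have jle : (j.-1)%:R <= (i.+2)%:R :> R.
  by rewrite -[i.+2%:R]natr1; move: qzw; rewrite ler_norml; lra.
rewrite ler_nat in jle.
have [] := far (j - i)%N i z w; rewrite ?subnKC // => h1 h2.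
have d4 : (j - i).+1%:R <= 4 :> R by rewrite (ler_nat R _ 4); lia.
split; lra.
Qed.

(** * Inverse limits *)

Section inverse_limit.
Context {R : realType} (I : Type) (lt : I -> I -> Prop)
  (P : I -> pseudoMetricType R) (p : forall b a : I, P b -> P a).
Hypothesis smith : smith_system lt P (@p).
Let L := inv_limit lt P (@p).

Definition limit_coord a (x : L) : P a := set_val x a.

Let lt_total a b : lt a b \/ a = b \/ lt b a.
Proof. by have [[_ [_ [h _]]] _] := smith. Qed.

Let hP a : hausdorff_space (P a).
Proof. by have [_ [h _]] := smith. Qed.

Let cP a : compact [set: P a].
Proof. by have [_ [_ [/(_ a)[[_ []]]]]] := smith. Qed.

Let dP a : directed_functions R (P a).
Proof.
have [_ [_ [/(_ a)[_ [chP _]] _]]] := smith.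
exact: chainable_directed.
Qed.

Let nP a : nested_continua (P a).
Proof.
have [_ [_ [/(_ a)[_ [_ [hiP _]]] _]]] := smith.
exact: hereditarily_indecomposable_nested.
Qed.

Lemma limit_coord_lt a b (x : L) : lt a b ->
  @p b a (limit_coord b x) = limit_coord a x.
Proof. by move=> ab; have /= := set_valP x; exact. Qed.

Lemma limit_coord_inj (x y : L) :
  (forall a, limit_coord a x = limit_coord a y) -> x = y.
Proof. by move=> xy; apply: val_inj; apply: functional_extensionality_dep. Qed.

Lemma set_val_continuous (T : topologicalType) (A : set T) :
  continuous (set_val : A -> T).
Proof. exact: initial_continuous. Qed.

Lemma limit_coord_continuous a : continuous (limit_coord a).
Proof.
have ca : continuous (fun s : prod_topology P => s a).
  exact: (@coord_continuous {classic I} P a).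
exact: (comp_continuous (@set_val_continuous _ L) ca).
Qed.

Lemma limit_hausdorff : hausdorff_space L.
Proof.
rewrite open_hausdorff => x y /eqP xy.
have /existsNP[a /eqP xya] : ~ forall a, limit_coord a x = limit_coord a y.
  by move=> /limit_coord_inj.
have [[U V] /= [Ux Vy] [oU oV UV]] : exists2 AB : set (P a) * set (P a),
    limit_coord a x \in AB.1 /\ limit_coord a y \in AB.2 &
    [/\ open AB.1, open AB.2 & AB.1 `&` AB.2 == set0].
  by have := @hP a; rewrite open_hausdorff; exact.
have /continuousP cl := @limit_coord_continuous a.
exists (limit_coord a @^-1` U, limit_coord a @^-1` V) => /=.
  by rewrite !inE in Ux Vy *.
split; [exact: cl|exact: cl|].
by rewrite -preimage_setI (eqP UV) preimage_set0.
Qed.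

Lemma limit_common_index a b : exists c,
  forall x y : L, limit_coord c x = limit_coord c y ->
    limit_coord a x = limit_coord a y /\ limit_coord b x = limit_coord b y.
Proof.
have [ab|[->|ba]] := lt_total a b.
- by exists b => x y xy; rewrite -!(limit_coord_lt _ ab) xy.
- by exists b.
- by exists a => x y xy; rewrite -!(limit_coord_lt _ ba) xy.
Qed.

(** Incomparability of [A] and [B] is witnessed by two points, and by compactness a single
    coordinate detects both; there the images would be incomparable continua with a common point. *)
Lemma limit_nested : nested_continua L.
Proof.
have escape (A B : set L) a : compact B -> A a -> ~ B a ->
    exists i, ~ (limit_coord i @` B) (limit_coord i a).
  move=> cB Aa nBa; apply/existsNP => Ba.
  have [i _] : exists i : I, True.
    apply: contrapT => nI; have [[_ [_ [_ [_ [ncI _]]]]] _] := smith.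
    apply: ncI; rewrite (_ : setT = set0) //.
    by rewrite -subset0 => i _; apply: nI; exists i.
  have [j|j k|j|x [Bx xa]] := @compact_directed_inter L B I
    (fun j => [set x | limit_coord j x = limit_coord j a]) i cB.
  - have /continuous_closedP h := @limit_coord_continuous j.
    apply: (h [set limit_coord j a]).
    exact/accessible_closed_set1/hausdorff_accessible.
  - have [c cjk] := limit_common_index j k.
    by exists c => x /cjk.
  - by have [x Bx xa] := Ba j; exists x.
  by apply: nBa; rewrite -(limit_coord_inj xa).
move=> A B [A0 [cA coA]] [B0 [cB coB]] [z [Az Bz]].
apply: contrapT => /not_orP[/existsNP[a /not_implyP[Aa nBa]]
  /existsNP[b /not_implyP[Bb nAb]]].
have [i ia] := escape _ _ _ cB Aa nBa; have [j jb] := escape _ _ _ cA Bb nAb.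
have [k kij] := limit_common_index i j.
have cl := @limit_coord_continuous k.
have cont C : C z -> compact C -> connected C -> continuum (limit_coord k @` C).
  move=> Cz cC coC; split; first by exists (limit_coord k z); exists z.
  by split; [exact: continuous_image_compact|exact: continuous_image_connected].
have [|AB|BA] := nP (cont A Az cA coA) (cont B Bz cB coB).
- by exists (limit_coord k z); split; exists z.
- have [|c Bc ca] := AB (limit_coord k a); first by exists a.
  by apply: ia; exists c => //; have [] := kij _ _ ca.
- have [|c Ac cb] := BA (limit_coord k b); first by exists b.
  by apply: jb; exists c => //; have [] := kij _ _ cb.
Qed.

(** The functions pulled back from single coordinates are directed, as two coordinates factor
    through the later one, and they separate points. By compactness the closeness relation of one of
    them avoids the closed set of pairs where [u1] or [u2] differs by at least 1. *)
Lemma limit_directed : compact [set: L] -> directed_functions R L.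
Proof.
move=> cL u1 u2 cu1 cu2.
pose bad := [set z : L * L | 1 <= `|u1 z.1 - u1 z.2|] `|`
            [set z : L * L | 1 <= `|u2 z.1 - u2 z.2|].
have cdiff (T : topologicalType) (u : T -> R) : continuous u ->
    continuous (fun z : T * T => `|u z.1 - u z.2|).
  move=> cu; apply: norm_fun_continuous; apply: add_fun_continuous.
    exact: (comp_continuous (@fst_continuous _ _) cu).
  apply: opp_fun_continuous.
  exact: (comp_continuous (@snd_continuous _ _) cu).
have cbad : compact bad.
  have cLL : compact [set: L * L].
    rewrite (_ : setT = [set: L] `*` [set: L]); first exact: compact_setX.
    by apply/seteqP; split.
  apply: (subclosed_compact _ cLL) => //.
  by apply: closedU; apply: closed_superlevel; exact: cdiff.
pose fam a := {q : P a -> R | continuous q}.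
pose J := {a : I & fam a}.
pose F (j : J) := [set z : L * L |
  `|sval (tagged j) (limit_coord (tag j) z.1)
    - sval (tagged j) (limit_coord (tag j) z.2)| <= 1].
have cq (j : J) : continuous (fun x => sval (tagged j) (limit_coord (tag j) x)).
  by apply: (comp_continuous (@limit_coord_continuous _)); exact: (svalP (tagged j)).
suff [j jbad] : exists j, F j `&` bad = set0.
  exists (fun x => sval (tagged j) (limit_coord (tag j) x)); first exact: cq.
  move=> z w zw; have nbad : ~ bad (z, w).
    by move=> b; have : (F j `&` bad) (z, w); [|rewrite jbad].
  split; rewrite leNgt; apply/negP => /ltW h; apply: nbad.
    by left.
  by right.
apply: contrapT => nj.
have [i _] : exists i : I, True.
  apply: contrapT => nI; have [[_ [_ [_ [_ [ncI _]]]]] _] := smith.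
  apply: ncI; rewrite (_ : setT = set0) //.
  by rewrite -subset0 => i _; apply: nI; exists i.
have [j|j k|j|[z w] [badzw Fzw]] := @compact_directed_inter _ bad J F
  (Tagged fam (exist _ (cst 0) (@cst_continuous _ _ 0) : fam i)) cbad.
- by apply: closed_sublevel; exact: (cdiff _ _ (cq j)).
- have pull a b : lt a b -> forall q : P a -> R, continuous q ->
      continuous (fun x => q (@p b a x)).
    move=> ab q cq'; apply: comp_continuous cq'.
    by have [_ [_ [_ [h _]]]] := smith; exact: h.
  have [c [v1 [v2 [cv1 cv2 v1E v2E]]]] : exists c (v1 v2 : P c -> R),
      [/\ continuous v1, continuous v2,
        forall x, v1 (limit_coord c x) = sval (tagged j) (limit_coord (tag j) x)
      & forall x, v2 (limit_coord c x) = sval (tagged k) (limit_coord (tag k) x)].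
    case: j k => [a [q1 cq1]] [b [q2 cq2]] /=.
    have [ab|[ab|ba]] := lt_total a b.
    + exists b, (fun x => q1 (@p b a x)), q2; split => //; first exact: pull.
      by move=> x; rewrite limit_coord_lt.
    + by subst b; exists a, q1, q2.
    + exists a, q1, (fun x => q2 (@p a b x)); split => //; first exact: pull.
      by move=> x; rewrite limit_coord_lt.
  have [q cq' qv] := dP cv1 cv2.
  exists (Tagged fam (exist _ q cq' : fam c)) => y.
  by rewrite /F /= => /qv; rewrite !v1E !v2E.
- apply: contrapT => nF; apply: nj; exists j; exact/nonemptyPn.
suff zw : z = w.
  by case: badzw => /=; rewrite zw subrr normr0 ler10.
apply: limit_coord_inj => a; apply: contrapT => zwa.
have [u cu] := continuous_separates (R := R) (@hP a) (@cP a) zwa.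
have := Fzw (Tagged fam (exist _ u cu : fam a)).
by rewrite /F /= leNgt => /negP.
Qed.

End inverse_limit.

Section subspace_power.
Context {K : eqType} {T : topologicalType} (L : set T) (x0 : L).
Local Notation S := (prod_topology (fun _ : K => L)).
Local Notation S' := (prod_topology (fun _ : K => T)).

Definition power_incl (s : S) : S' := fun k => set_val (s k).

(** The default [x0] makes the inverse of [power_incl] total; continuity holds within
    [cpower K L]. *)
Definition power_restr (f : S') : S := fun k =>
  if pselect (L (f k)) is left h then exist _ (f k) (mem_set h) else x0.

Lemma power_incl_continuous : continuous power_incl.
Proof.
apply: prod_continuous => k.
exact: (comp_continuous (@coord_continuous _ _ k) (@set_val_continuous _ L)).
Qed.

Lemma power_incl_mem s : cpower K L (power_incl s).
Proof. by move=> k; exact: set_valP. Qed.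

Lemma power_restrK f : cpower K L f -> power_incl (power_restr f) = f.
Proof.
move=> Lf; apply/funext => k; rewrite /power_incl /power_restr.
by case: pselect => // /(_ (Lf k)).
Qed.

Lemma power_inclK s : power_restr (power_incl s) = s.
Proof.
apply/funext => k; apply: val_inj.
exact: (congr1 (@^~ k) (power_restrK (power_incl_mem s))).
Qed.

Lemma power_restr_continuous : {within cpower K L, continuous power_restr}.
Proof.
apply/subspace_continuousP => f Lf; apply/cvg_sup => k U.
move=> [V [[W [W' oW' <-] <-] W'f] WU]; apply: (filterS WU).
have fk z : cpower K L z -> set_val (power_restr z k) = z k.
  by move=> Lz; exact: (congr1 (@^~ k) (power_restrK Lz)).
have : nbhs f (fun z : S' => W' (z k)).
  apply: (@coord_continuous _ _ k f W'); apply: open_nbhs_nbhs; split => //.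
  by move: W'f; rewrite /= fk.
by apply: filterS => z W'z Lz; rewrite /= fk.
Qed.

End subspace_power.

(** [M] is carried to the power of the subspace type [L], where [power_fupcon] applies, and [V] is
    carried back. [L] is compact and connected as the image of [M'] under the coordinate [k0]. *)
Lemma fupcon_power_subspace (R : realType) (T : topologicalType) (L : set T)
    (K : Type) (k0 : K) :
  hausdorff_space L -> nested_continua L ->
  (compact [set: L] -> directed_functions R L) -> fupcon_power K L.
Proof.
move=> hL nL dL M ML [[f0 Mf0] [cM coM]] Mk U UL [W [oW UE]] MU.
pose K' : eqType := {classic K}.
pose x0 : L := exist _ (f0 k0) (mem_set (ML _ Mf0 k0)).
pose incl := @power_incl K' T L; pose restr := @power_restr K' T L x0.
have crestr : {within M, continuous restr}.
  by apply: continuous_subspaceW ML (@power_restr_continuous K' T L x0).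
pose M' := restr @` M.
have cM' : compact M' by exact: continuous_compact.
have coM' : connected M' by exact: connected_continuous_connected.
have M'k (k : K') b : exists2 s, M' s & s k = b.
  have : [set f k | f in M] (set_val b) by rewrite Mk; exact: set_valP.
  move=> [f Mf fk]; exists (restr f); first by exists f.
  apply: val_inj; rewrite -[RHS]fk.
  exact: (congr1 (@^~ k) (@power_restrK K' T L x0 f (ML _ Mf))).
have M'0 : M' !=set0 by exists (restr f0); exists f0.
have LE : [set: L] = (fun s : prod_topology (fun _ : K' => L) => s k0) @` M'.
  by apply/seteqP; split => // b _; have [s M's sb] := M'k k0 b; exists s.
have ck0 := @coord_continuous K' (fun _ => L) k0.
have cL : compact [set: L] by rewrite LE; exact: continuous_image_compact.
have coL : connected [set: L] by rewrite LE; exact: continuous_image_connected.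
have oU' : open (incl @^-1` W).
  by have /continuousP := @power_incl_continuous K' T L; exact.
have M'U' : M' `<=` incl @^-1` W.
  move=> _ [f Mf <-]; rewrite /= /incl power_restrK; last exact: (ML _ Mf).
  by have := MU _ Mf; rewrite UE => -[].
have [V [oV coV M'V VU']] :=
  power_fupcon hL cL coL nL (dL cL) (conj M'0 (conj cM' coM')) M'k oU' M'U'.
exists (incl @` V); split.
  have /continuousP/(_ _ oV)/open_subspaceP[W2 oW2 W2E] :=
    @power_restr_continuous K' T L x0.
  exists W2; split => //; rewrite W2E; apply/seteqP; split => f.
    move=> [s Vs <-]; split; last exact: power_incl_mem.
    have sK : restr (incl s) = s by exact: (@power_inclK K' T L x0).
    by rewrite -[s]sK in Vs.
  by move=> [Vf Lf]; exists (restr f) => //; exact: power_restrK.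
split.
  by apply: continuous_image_connected => //; exact: power_incl_continuous.
split => f.
  move=> Mf; exists (restr f); first by apply: M'V; exists f.
  by apply: power_restrK; exact: (ML _ Mf).
move=> [s Vs <-]; rewrite UE; split; first exact: VU'.
exact: (@power_incl_mem K' T L s).
Qed.

Theorem theorem3 (R : realType) (I : Type) (lt : I -> I -> Prop)
  (P : I -> pseudoMetricType R) (p : forall b a : I, P b -> P a)
  (K : Type) :
  smith_system lt P p -> inhabited K ->
  fupcon_power K (inv_limit lt P p).
Proof.
move=> smith [k0]; apply: (fupcon_power_subspace (R := R) k0).
- exact: limit_hausdorff smith.
- exact: limit_nested smith.
- exact: limit_directed smith.
Qed.
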